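(* Let $F\in L^2_{\mathbb{X}}$ have the infinite Hoeffding decomposition $F=\sum_{M\in\mathcal{P}_{fin}(\mathbb{N})}F_M$. Then, for any $M=\{i_1,\dotsc,i_p\}\in\mathcal{P}_{fin}(\mathbb{N})$ (with $|M|=p$), $$F_M=\mathbb{E}\bigl[D_{i_1}D_{i_2}\cdots D_{i_p}F\,\big|\,\mathcal{F}_M\bigr].$$ Thus, in the $L^2(\mathbb{P})$-sense, $$F=\mathbb{E}[F]+\sum_{p=1}^\infty\ \sum_{1\leq i_1<i_2<\dotsb<i_p<\infty}\mathbb{E}\bigl[D_{i_1}D_{i_2}\cdots D_{i_p}F\,\big|\,\mathcal{F}_{\{i_1,\dotsc,i_p\}}\bigr]=\mathbb{E}[F]+\sum_{p=1}^\infty\frac{1}{p!}\sum_{(i_1,\dotsc,i_p)\in\mathbb{N}^p_{\neq}}\mathbb{E}\bigl[D_{i_1}D_{i_2}\cdots D_{i_p}F\,\big|\,\mathcal{F}_{\{i_1,\dotsc,i_p\}}\bigr].$$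
   Context: Let $\mathbb{X}=(X_n)_{n\in\mathbb{N}}$ be a sequence of independent random variables on a probability space $(\Omega,\mathcal{A},\mathbb{P})$, $X_n$ taking values in an arbitrary measurable space $(E_n,\mathcal{B}_n)$. Let $\mathcal{F}=\sigma(\mathbb{X})$, $\mathcal{F}_M=\sigma(X_j: j\in M)$ for $M\subseteq\mathbb{N}$, $\mathcal{G}_k=\sigma(X_j:j\ne k)$, and $L^2_{\mathbb{X}}=L^2(\Omega,\mathcal{F},\mathbb{P})$. For $F\in L^2_{\mathbb X}$ and $k\in\mathbb{N}$ put $D_kF:=F-\mathbb{E}[F\mid\mathcal{G}_k]$. $\mathbb{N}^p_{\ne}$ is the set of $p$-tuples of pairwise distinct natural numbers. $\mathcal{P}_{fin}(\mathbb{N})$ is the set of finite subsets of $\mathbb{N}$. For $F\in L^2_{\mathbb{X}}$ and $M\in\mathcal{P}_{fin}(\mathbb{N})$ let $F_M:=\sum_{L\subseteq M}(-1)^{|M|-|L|}\mathbb{E}[F\mid\mathcal{F}_L]$ (the Hoeffding components). Each $F_M$ is $\mathcal{F}_M$-measurable, $\mathbb{E}[F_M\mid\mathcal{F}_K]=0$ a.s. unless $M\subseteq K$, the $F_M$ are pairwise orthogonal, and $F=\sum_{M\in\mathcal{P}_{fin}(\mathbb{N})}F_M=\sum_{p=0}^\infty\sum_{|M|=p}F_M$ with unconditional convergence of all series in $L^2(\mathbb{P})$; this is the infinite Hoeffding decomposition of $F$. *)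

(* Defs.v *)
From HB Require Import structures.
From mathcomp Require Import all_boot all_order all_algebra finmap.
From mathcomp Require Import all_classical all_reals all_analysis.
From mathcomp Require Import summability.

Set Implicit Arguments.
Unset Strict Implicit.
Unset Printing Implicit Defensive.

Import Order.TTheory GRing.Theory Num.Theory.
Import numFieldNormedType.Exports.

Local Open Scope classical_set_scope.
Local Open Scope ring_scope.

Section conditional_expectation.
Context d (T : measurableType d) (R : realType) (P : probability T R).

(* [G] is meant to be a sub-sigma-algebra of the measurable sets of [T]; then
   the measurable sets of [g_sigma_algebraType G] are exactly those of [G]. *)
Definition is_cond_exp (G : set_system T) (F Y : T -> R) :=
  [/\ measurable_fun [set: g_sigma_algebraType G]
        (Y : g_sigma_algebraType G -> R),
      P.-integrable [set: T] (EFin \o Y) &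
      forall A, G A ->
        (\int[P]_(x in A) (Y x)%:E = \int[P]_(x in A) (F x)%:E)%E].

(* A chosen version of E[F | G]. For integrable [F], a version exists by
   Radon-Nikodym and is a.s. unique, so a.s. and L^2 statements do not depend
   on the choice; the default value 0 is only reached for other [F]. *)
Definition cond_exp (G : set_system T) (F : T -> R) : T -> R :=
  xget (cst 0) [set Y | is_cond_exp G F Y].

(* [s] is the sum in L^2(P), in the sense of unconditional convergence, of the
   family [f i] indexed by the [i] satisfying [D]: [totally] is the filter of
   finite sets of indices directed by inclusion. *)
Definition L2_sum (I : choiceType) (D : pred I) (f : I -> T -> R)
    (s : T -> R) : Prop :=
  [/\ (forall i, D i -> f i \in Lfun P 2%:E),
      s \in Lfun P 2%:E &
      (fun J : {fset I} =>
         'N[P]_2%:E[EFin \o (fun x => s x - \sum_(i <- J | D i) f i x)%R]%E)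
        @ totally --> 0%E].

End conditional_expectation.

Section random_sequence.
Context d (T : measurableType d) (R : realType) (P : probability T R).
Context (dE : nat -> measure_display) (E : forall n, measurableType (dE n)).
Variable X : forall n, {RV P >-> E n}.

Definition mutually_independent : Prop :=
  forall (J : {fset nat}) (B : forall n, set (E n)),
    (forall n, measurable (B n)) ->
    P (\bigcap_(n in [set` J]) (X n @^-1` B n)) =
    (\prod_(n <- J) fine (P (X n @^-1` B n)))%:E.

(* F_M = sigma(X_j : j \in M) *)
Definition sigma_of (M : set nat) : set_system T :=
  <<s \bigcup_(j in M) g_sigma_algebra_preimage (X j) >>.

(* Square-integrable representatives of the elements of L^2_X. *)
Definition L2X (F : T -> R) : Prop :=
  F \in Lfun P 2%:E /\
  measurable_fun [set: g_sigma_algebraType (sigma_of [set: nat])]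
    (F : g_sigma_algebraType (sigma_of [set: nat]) -> R).

Definition Dop (k : nat) (F : T -> R) : T -> R :=
  fun x => F x - cond_exp P (sigma_of [set j | j != k]) F x.

(* D_{i_1} D_{i_2} ... D_{i_p} F for s = [:: i_1; ...; i_p] *)
Definition iter_Dop (s : seq nat) (F : T -> R) : T -> R := foldr Dop F s.

Definition hoeffding_component (F : T -> R) (M : {fset nat}) : T -> R :=
  fun x => \sum_(L <- fpowerset M)
    (-1) ^+ (#|` M| - #|` L|) * cond_exp P (sigma_of [set` L]) F x.

End random_sequence.

(* Main.v *)
Require Import Defs.
From mathcomp Require Import all_boot all_order all_algebra finmap.
From mathcomp Require Import all_classical all_reals all_analysis.
From mathcomp Require Import measurable_realfun summability ring lra.

Set Implicit Arguments.
Unset Strict Implicit.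
Unset Printing Implicit Defensive.

Import Order.TTheory GRing.Theory Num.Theory.
Import numFieldNormedType.Exports.

Local Open Scope classical_set_scope.
Local Open Scope ring_scope.

(** Write [E_K] for the conditional expectation given the variables indexed by
    [K]. On square-integrable functions [E_K] is the orthogonal projection onto
    the functions measurable for the sigma-algebra [F_K] of those variables
    ([inner_cond_exp]), and independence enters only through one algebraic rule,
    [E_K E_L = E_(K :&: L)] ([condE_condE]), proved by checking integrals over
    cylinders and the pi-lambda theorem.

    The rule settles the formula for the components. As [D_k = 1 - E_(~ k)],
    projecting [D_k G] onto [F_K] with [k] in [K] gives [E_K G - E_(K :\ k) G].
    Iterated over the elements of [M], this is the recursion satisfied by the
    alternating sum over the subsets of [M] that defines the component
    ([component_differences]). Since the [D_k] may be taken in any order, the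
    component of [M] is killed by [E_K] as soon as [K] misses a point of [M]
    ([component_vanish]); hence components of distinct sets are orthogonal.
    Moebius inversion writes [E_M F] as the sum of the components of the subsets
    of [M], which gives [<F, F_M> = <F_M, F_M>] and Bessel's inequality.

    Bessel's inequality and the completeness of [L^2] ([L2_complete]) make every
    family of components summable. The sum over all finite sets is [F], because
    the difference is orthogonal to all functions of finitely many variables,
    hence to the indicators of all cylinders ([condE_total],
    [hoeffding_decomposition]). Collecting the sets of each cardinality gives
    the series over [p] ([has_sum_grades]). A set of cardinality [p] is listed
    by one increasing tuple and by [p`!] tuples without repetition, which
    accounts for the two indexings of the inner sums ([has_sum_fibres]).

    Almost sure equality is handled in the weak form [weq]: two functions are
    identified when they have the same scalar products with all others. This
    form passes through the projections because they are self-adjoint. *)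

(** * Unconditional sums in a semi-inner product space *)

(** Functions that agree almost surely stay distinct vectors, so the form on
    square-integrable functions is only positive semidefinite. *)
Record semi_inner (R : realType) (V : lmodType R) (ip : V -> V -> R) : Prop :=
  SemiInner {
    ipDl : forall x y z, ip (x + y) z = ip x z + ip y z;
    ipZl : forall a x z, ip (a *: x) z = a * ip x z;
    ipC : forall x y, ip x y = ip y x;
    ip_ge0 : forall x, 0 <= ip x x }.

Lemma le0_of_small (R : realFieldType) (c K : R) :
  (forall e : R, 0 < e -> c <= e * K) -> c <= 0.
Proof.
move=> h; rewrite leNgt; apply/negP => c0.
have K0 : 0 < K by have := h 1 ltr01; rewrite mul1r; exact: lt_le_trans.
have := h (c / (2 * K)); rewrite divr_gt0 ?mulr_gt0// => /(_ isT).
rewrite (_ : c / (2 * K) * K = c / 2); first lra.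
by field; rewrite gt_eqF.
Qed.

Section semi_inner_theory.
Context (R : realType) (V : lmodType R) (ip : V -> V -> R).
Context (hip : semi_inner ip).

Lemma ipDr x y z : ip z (x + y) = ip z x + ip z y.
Proof. by rewrite (ipC hip) (ipDl hip) !(ipC hip z). Qed.

Lemma ipZr a x z : ip z (a *: x) = a * ip z x.
Proof. by rewrite (ipC hip) (ipZl hip) (ipC hip z). Qed.

Lemma ipNl x z : ip (- x) z = - ip x z.
Proof. by rewrite -scaleN1r (ipZl hip) mulN1r. Qed.

Lemma ipNr x z : ip z (- x) = - ip z x.
Proof. by rewrite -scaleN1r ipZr mulN1r. Qed.

Lemma ipBl x y z : ip (x - y) z = ip x z - ip y z.
Proof. by rewrite (ipDl hip) ipNl. Qed.

Lemma ipBr x y z : ip z (x - y) = ip z x - ip z y.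
Proof. by rewrite ipDr ipNr. Qed.

Lemma ip0l z : ip 0 z = 0.
Proof. by rewrite -(scale0r (0 : V)) (ipZl hip) mul0r. Qed.

Lemma ip0r z : ip z 0 = 0.
Proof. by rewrite (ipC hip) ip0l. Qed.

Lemma ip_suml I (r : seq I) (D : pred I) (f : I -> V) z :
  ip (\sum_(i <- r | D i) f i) z = \sum_(i <- r | D i) ip (f i) z.
Proof.
exact: (big_morph (fun x => ip x z) (fun x y => ipDl hip x y z) (ip0l z)).
Qed.

Lemma ip_sumr I (r : seq I) (D : pred I) (f : I -> V) z :
  ip z (\sum_(i <- r | D i) f i) = \sum_(i <- r | D i) ip z (f i).
Proof.
exact: (big_morph (fun x => ip z x) (fun x y => ipDr x y z) (ip0r z)).
Qed.

Definition ipE := (ipDl hip, ipDr, ipBl, ipBr, ipZl hip, ipZr, ipNl, ipNr).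

Lemma cauchy_schwarz x y : ip x y ^+ 2 <= ip x x * ip y y.
Proof.
have [y0|y0] := eqVneq (ip y y) 0; last first.
  have y1 : 0 < ip y y by rewrite lt_neqAle eq_sym y0 ip_ge0.
  have := ip_ge0 hip (ip y y *: x - ip x y *: y).
  rewrite !ipE (ipC hip y x).
  by rewrite (_ : _ - _ = ip y y * (ip x x * ip y y - ip x y ^+ 2));
    [rewrite pmulr_rge0// subr_ge0|ring].
rewrite y0 mulr0; apply: (@le0_of_small _ _ (ip x x)) => e e0.
have := ip_ge0 hip (e *: x - (ip x y) *: y).
rewrite !ipE (ipC hip y x) y0 => h.
have {}h : 0 <= e * (e * ip x x - 2 * ip x y ^+ 2).
  by move: h; congr (_ <= _); ring.
rewrite pmulr_rge0// in h.
have := sqr_ge0 (ip x y); lra.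
Qed.

(** Semi-inner products see only the class of a vector modulo the null
    vectors, so equality of vectors is used in this weak form. *)
Definition weq x y := forall z, ip x z = ip y z.

Lemma ip_null x y : ip x x = 0 -> ip x y = 0.
Proof.
move=> x0; have := cauchy_schwarz x y; rewrite x0 mul0r => h.
by apply/eqP; rewrite -sqrf_eq0 eq_le h sqr_ge0.
Qed.

Lemma sq_small_eq0 c y :
  (forall e : R, 0 < e -> exists2 x, ip x x <= e & ip x y = c) -> c = 0.
Proof.
move=> h; suff : c ^+ 2 <= 0.
  by move=> c0; apply/eqP; rewrite -sqrf_eq0 eq_le c0 sqr_ge0.
apply: (@le0_of_small _ _ (ip y y)) => e /h[x xe <-].
by apply: le_trans (cauchy_schwarz _ _) _; rewrite ler_wpM2r ?ip_ge0.
Qed.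

Definition sq_cvg (u : nat -> V) (s : V) :=
  forall e : R, 0 < e ->
    exists N, forall n, (N <= n)%N -> ip (u n - s) (u n - s) <= e.

Definition sq_complete (C : V -> Prop) := forall u : nat -> V,
  (forall n, C (u n)) ->
  (forall e : R, 0 < e -> exists N, forall m n, (N <= m)%N -> (m <= n)%N ->
    ip (u n - u m) (u n - u m) <= e) ->
  exists2 s, C s & sq_cvg u s.

(** The projection is the limit of a minimizing sequence for the distance:
    by the parallelogram identity such a sequence is Cauchy. *)
Lemma projection (C : V -> Prop) (x : V) : C 0 ->
  (forall a y z, C y -> C z -> C (a *: y + z)) -> sq_complete C ->
  exists2 y, C y & forall z, C z -> ip (x - y) z = 0.
Proof.
move=> C0 CL Cc.
pose sq y := ip y y.
pose A := [set sq (x - z) | z in [set z | C z]].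
have Ainf : has_inf A.
  split; first by exists (sq (x - 0)), 0.
  by exists 0 => _ [z _ <-]; exact: ip_ge0.
have dle z : C z -> inf A <= sq (x - z).
  by move=> Cz; apply: ge_inf; [exact: Ainf.2|exists z].
have pos n : 0 < n.+1%:R^-1 :> R by rewrite invr_gt0.
have /choice[u uP] : forall n, exists u, C u /\ sq (x - u) < inf A + n.+1%:R^-1.
  by move=> n; have [_ [z Cz <-] h] := inf_adherent (pos n) Ainf; exists z.
have [|e e0|y Cy uy] := Cc u; first by move=> n; have [] := uP n.
  pose N := Num.truncn (4 * e^-1).
  have hN n : (N <= n)%N -> n.+1%:R^-1 <= e / 4 :> R.
    move=> Nn; rewrite -[e / 4]invrK lef_pV2 ?posrE ?invr_gt0 ?divr_gt0//.
    rewrite invf_div; apply: le_trans (ltW (truncnS_gt _)) _.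
    by rewrite ler_nat ltnS.
  exists N => m n Nm mn.
  have [Cm um] := uP m; have [Cn un] := uP n.
  have hm := hN _ Nm; have hn := hN _ (leq_trans Nm mn).
  (* compare with the midpoint of u m and u n *)
  have Cz : C (2^-1 *: u m + (2^-1 *: u n + 0)) by do 2!apply: (CL) => //.
  have key : sq (u n - u m) = 2 * sq (x - u m) + 2 * sq (x - u n) -
      4 * sq (x - (2^-1 *: u m + (2^-1 *: u n + 0))).
    rewrite /sq addr0 !ipE.
    rewrite (ipC hip (u n) x) (ipC hip (u m) x) (ipC hip (u m) (u n)); lra.
  rewrite -/(sq _) key; have := dle _ Cz; move: um un hm hn.
  move: (m.+1%:R^-1 : R) (n.+1%:R^-1 : R) (inf A : R) => /= a b c *.
  lra.
exists y => // z Cz.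
suff : ip (x - y) z ^+ 2 <= 0.
  by move=> c0; apply/eqP; rewrite -sqrf_eq0 eq_le c0 sqr_ge0.
apply: (@le0_of_small _ _ (4 * sq z)) => e e0.
have [N hN] := uy _ e0.
pose n := maxn N (Num.truncn e^-1).
have Nn : n.+1%:R^-1 <= e :> R.
  rewrite -[e]invrK lef_pV2 ?posrE ?invr_gt0//.
  apply: le_trans (ltW (truncnS_gt _)) _.
  by rewrite ler_nat ltnS leq_maxr.
have {}hN := hN n (leq_maxl _ _).
have [Cn un] := uP n.
have h1 : ip (x - u n) z ^+ 2 <= e * sq z.
  have [z0|z0] := eqVneq (sq z) 0.
    by have := cauchy_schwarz (x - u n) z; rewrite -/(sq z) z0 !mulr0.
  have zp : 0 < sq z by rewrite lt_neqAle eq_sym z0 ip_ge0.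
  (* compare u n with the better candidate that removes the z-component *)
  have := dle _ (CL (ip (x - u n) z / sq z) _ _ Cz Cn).
  rewrite [_ + u n]addrC opprD addrA; move: (x - u n) un => w un.
  have -> : sq (w - ip w z / sq z *: z) = sq w - ip w z ^+ 2 / sq z.
    by rewrite /sq !ipE (ipC hip z w) -/(sq z); field.
  rewrite -ler_pdivrMr// => h; move: un Nn h.
  move: (n.+1%:R^-1 : R) (inf A : R) => /= b c *; lra.
have h2 : ip (u n - y) z ^+ 2 <= e * sq z.
  by apply: le_trans (cauchy_schwarz _ _) _; rewrite ler_wpM2r ?ip_ge0.
rewrite -(subrK (u n) x) -addrA (ipDl hip).
have := sqr_ge0 (ip (x - u n) z - ip (u n - y) z).
move: h1 h2; set a := ip _ _; set b := ip _ _; nra.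
Qed.

Definition has_sum (I : choiceType) (D : pred I) (f : I -> V) (s : V) :=
  forall e : R, 0 < e -> exists J0 : {fset I}, forall J, (J0 `<=` J)%fset ->
    ip (s - \sum_(i <- J | D i) f i) (s - \sum_(i <- J | D i) f i) <= e.

End semi_inner_theory.

Lemma big_fsubset (M : nmodType) (I : choiceType) (D : pred I) (f : I -> M)
    (J0 J : {fset I}) : (J0 `<=` J)%fset ->
  \sum_(i <- J0 | D i) f i = \sum_(i <- J | D i && (i \in J0)) f i.
Proof.
move=> /fsubsetP h; rewrite -big_filter -[RHS]big_filter; apply: perm_big.
apply: uniq_perm; rewrite ?filter_uniq// => i; rewrite !mem_filter -andbA.
by congr (_ && _); apply/idP/andP => [iJ|[]//]; split => //; exact: h.
Qed.

Section has_sum_theory.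
Context (R : realType) (V : lmodType R) (ip : V -> V -> R).
Context (hip : semi_inner ip).
Local Notation weq := (weq ip).
Local Notation has_sum := (has_sum ip).

(** The sign condition makes the error decrease when terms are added to a
    partial sum, so that one good partial sum is enough. *)
Lemma has_sum_crit (I : choiceType) (D : pred I) (f : I -> V) (s : V) :
  (forall (J : {fset I}) i, i \in J -> D i ->
     0 <= ip (s - \sum_(j <- J | D j) f j) (f i)) ->
  (forall e : R, 0 < e -> exists J : {fset I},
    ip (s - \sum_(i <- J | D i) f i) (s - \sum_(i <- J | D i) f i) <= e) ->
  has_sum D f s.
Proof.
move=> h1 h2 e /h2[J0 hJ0]; exists J0 => J J0J; apply: le_trans hJ0.
set a := s - _.
have -> : s - \sum_(i <- J0 | D i) f i =
    a + \sum_(i <- J | D i && (i \notin J0)) f i.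
  rewrite (big_fsubset _ _ J0J) /a.
  rewrite [X in s - X + _](bigID (fun i => i \in J0))/=.
  by rewrite opprD -!addrA addNr addr0.
set b := \sum_(i <- J | _) _.
have ab : 0 <= ip a b.
  rewrite (ip_sumr hip) big_seq_cond; apply: sumr_ge0 => i /and3P[iJ Di _].
  exact: h1.
move: a b ab => a b ab; have := ip_ge0 hip b.
by rewrite !(ipE hip) (ipC hip b a); lra.
Qed.

(** Scalar products with a sum are limits of those with the partial sums; the
    families at hand make the latter eventually constant. *)
Lemma has_sum_ip (I : choiceType) (D : pred I) (f : I -> V) s y c J0 :
  has_sum D f s ->
  (forall J : {fset I}, (J0 `<=` J)%fset ->
    ip (\sum_(i <- J | D i) f i) y = c) ->
  ip s y = c.
Proof.
move=> hs hc; apply/eqP; rewrite -subr_eq0; apply/eqP.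
apply: (sq_small_eq0 hip (y := y)) => e /hs[J1 hJ].
exists (s - \sum_(i <- (J0 `|` J1)%fset | D i) f i).
  by apply: hJ; exact: fsubsetUr.
by rewrite (ipBl hip) hc// fsubsetUl.
Qed.

Definition orthogonal_family (I : choiceType) (D : pred I) (f : I -> V) :=
  forall i j, D i -> D j -> i != j -> ip (f i) (f j) = 0.

Lemma orthogonal_ip_sum (I : choiceType) (D : pred I) (f : I -> V)
    (J : {fset I}) i : orthogonal_family D f -> i \in J -> D i ->
  ip (\sum_(j <- J | D j) f j) (f i) = ip (f i) (f i).
Proof.
move=> ho iJ Di; rewrite (ip_suml hip) (big_rem i)//= Di.
rewrite big_seq_cond big1 ?addr0// => j /andP[].
by rewrite mem_rem_uniq// inE => /andP[ji _] Dj; exact: ho.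
Qed.

Lemma orthogonal_sq_sum (I : choiceType) (D : pred I) (f : I -> V)
    (J : {fset I}) : orthogonal_family D f ->
  ip (\sum_(j <- J | D j) f j) (\sum_(j <- J | D j) f j) =
  \sum_(j <- J | D j) ip (f j) (f j).
Proof.
move=> ho; rewrite {1}(ip_sumr hip) big_seq_cond [RHS]big_seq_cond.
by apply: eq_bigr => i /andP[iJ Di]; exact: orthogonal_ip_sum.
Qed.

Lemma orthogonal_has_sum_ip (I : choiceType) (D : pred I) (f : I -> V) s i :
  orthogonal_family D f -> has_sum D f s -> D i -> ip s (f i) = ip (f i) (f i).
Proof.
move=> ho hs Di; apply: (has_sum_ip (J0 := [fset i]%fset) hs) => J.
by rewrite fsub1set => iJ; exact: orthogonal_ip_sum.
Qed.

(** For a vector with the right coefficients the error of every partial sum is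
    orthogonal to the terms of that partial sum. *)
Lemma orthogonal_has_sum (I : choiceType) (D : pred I) (f : I -> V) s :
  orthogonal_family D f -> (forall i, D i -> ip s (f i) = ip (f i) (f i)) ->
  (forall e : R, 0 < e -> exists J : {fset I},
    ip (s - \sum_(i <- J | D i) f i) (s - \sum_(i <- J | D i) f i) <= e) ->
  has_sum D f s.
Proof.
move=> ho hs; apply: has_sum_crit => J i iJ Di.
by rewrite (ipBl hip) hs// orthogonal_ip_sum// subrr.
Qed.

(** Bounded sums of squares are Cauchy, so the partial sums along an
    enumeration of the index type converge; the limit does not depend on the
    enumeration because of [orthogonal_has_sum]. *)
Lemma orthogonal_summable (I : countType) (D : pred I) (f : I -> V)
    (C : V -> Prop) (K : R) :
  C 0 -> (forall a y z, C y -> C z -> C (a *: y + z)) -> sq_complete ip C ->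
  (forall i, D i -> C (f i)) -> orthogonal_family D f ->
  (forall J : {fset I}, \sum_(i <- J | D i) ip (f i) (f i) <= K) ->
  exists2 s, C s & has_sum D f s.
Proof.
move=> C0 CL Cc Cf ho hK.
pose J n : {fset I} := [fset i in pmap (@choice.unpickle I) (iota 0 n)]%fset.
have Jle m n : (m <= n)%N -> (J m `<=` J n)%fset.
  move=> mn; apply/fsubsetP => i; rewrite !inE !mem_pmap => /mapP[k].
  rewrite mem_iota/= => km ->; apply: map_f; rewrite mem_iota/=.
  exact: leq_trans km mn.
pose a n := \sum_(i <- J n | D i) ip (f i) (f i).
pose u n := \sum_(i <- J n | D i) f i.
have ua m n : (m <= n)%N -> ip (u n - u m) (u n - u m) = a n - a m.
  move=> /Jle mn; rewrite !(ipE hip) (ipC hip (u m)) !orthogonal_sq_sum//.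
  suff -> : ip (u n) (u m) = a m by rewrite -/(a n) -/(a m); lra.
  rewrite (ip_sumr hip) big_seq_cond [RHS]big_seq_cond.
  apply: eq_bigr => i /andP[iJ Di]; apply: orthogonal_ip_sum => //.
  exact: (fsubsetP mn).
have supa : has_sup (range a).
  by split; [exists (a 0), 0|exists K => _ [n _ <-]; exact: hK].
have [|e e0|s Cs us] := Cc u.
- move=> n; rewrite /u; elim/big_rec : _ => // i x Di Cx.
  by rewrite -[f i]scale1r; apply: CL => //; exact: Cf.
- have [_ [N _ <-] hN] := sup_adherent e0 supa.
  exists N => m n Nm mn; rewrite ua//.
  have : a n <= sup (range a) by apply: ub_le_sup; [exact: supa.2|exists n].
  have : a N <= a m.
    by rewrite -subr_ge0 -ua// ip_ge0.
  lra.
exists s => //; apply: orthogonal_has_sum => // [i Di|e e0].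
  apply/eqP; rewrite -subr_eq0; apply/eqP.
  apply: (sq_small_eq0 hip (y := f i)) => e /us[N hN].
  pose n := maxn N (@choice.pickle I i).+1.
  exists (s - u n).
    by have := hN n (leq_maxl _ _); rewrite -opprB (ipNl hip) (ipNr hip) opprK.
  rewrite (ipBl hip) orthogonal_ip_sum// inE mem_pmap; apply/mapP.
  exists (@choice.pickle I i); last by rewrite choice.pickleK.
  by rewrite mem_iota/= /n leq_maxr.
have [N hN] := us _ e0; exists (J N).
by have := hN N (leqnn _); rewrite -opprB (ipNl hip) (ipNr hip) opprK.
Qed.

(** Passing from indices [i] in [D] to indices [j] in [D'] with [q j = i], each
    of the [N] elements of the fibre [Fib i] contributing the same term. *)
Lemma has_sum_fibres (I I' : choiceType) (D : pred I) (D' : pred I')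
    (q : I' -> I) (Fib : I -> {fset I'}) (N : nat) (f : I -> V) (f' : I' -> V)
    (s : V) :
  (forall j, D' j -> D (q j)) ->
  (forall i j, (j \in Fib i) = D' j && (q j == i)) ->
  (forall i, D i -> #|` Fib i| = N) ->
  (forall j, D' j -> weq (f' j) (f (q j))) ->
  orthogonal_family D f -> has_sum D f s -> has_sum D' f' (N%:R *: s).
Proof.
move=> qD FibP FibN f'f ho hs.
have cnt (J : {fset I'}) i : D i ->
    \sum_(j <- J | D' j && (q j == i)) (1 : R) = #|` (J `&` Fib i)%fset|%:R.
  move=> Di; rewrite big_const_seq iter_addr_0 -size_filter.
  congr (_ *+ _); apply: perm_size; apply: uniq_perm; rewrite ?filter_uniq//.
  by move=> j; rewrite mem_filter inE FibP// andbC.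
apply: has_sum_crit => [J j jJ D'j|e e0].
  rewrite (ipBl hip) (ipZl hip) !(ipC hip _ (f' j)) !f'f// !(ipC hip (f (q j))).
  rewrite (orthogonal_has_sum_ip ho hs) ?qD//.
  rewrite (ip_suml hip) (eq_bigr (fun k => ip (f (q k)) (f (q j)))); last first.
    by move=> k D'k; rewrite f'f.
  rewrite (bigID (fun k => q k == q j))/= [X in _ - (_ + X)]big1 ?addr0;
    last first.
    by move=> k /andP[D'k qkj]; apply: ho => //; exact: qD.
  rewrite (eq_bigr (fun=> 1 * ip (f (q j)) (f (q j)))); last first.
    by move=> k /andP[_ /eqP->]; rewrite mul1r.
  rewrite -mulr_suml cnt ?qD// -mulrBl mulr_ge0 ?ip_ge0// subr_ge0 ler_nat.
  by rewrite -(FibN (q j)) ?qD//; apply: fsubset_leq_card; exact: fsubsetIr.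
(* N ^ 2 is the exact factor; adding 1 also covers N = 0 *)
have e1 : 0 < e / (N%:R ^+ 2 + 1).
  by rewrite divr_gt0// ltr_wpDl// sqr_ge0.
have [J0 /(_ J0)] := hs _ e1; rewrite fsubset_refl => /(_ isT) hJ0.
pose J := [fset j | i in J0, j in Fib i]%fset.
exists J.
set a := s - _ in hJ0.
set b := _ - _; have ab : weq b (N%:R *: a).
  move=> y; rewrite /a /b !(ipE hip) mulrBr; congr (_ - _).
  rewrite !(ip_suml hip) (eq_bigr (fun k => ip (f (q k)) y)); last first.
    by move=> k D'k; rewrite f'f.
  pose G i := ip (f i) y.
  transitivity (\sum_(j <- J | D' j) \sum_(i <- J0 | D i && (q j == i)) G i).
    rewrite big_seq_cond [RHS]big_seq_cond; apply: eq_bigr => j /andP[+ D'j].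
    move=> /imfset2P[/= i iJ0 [k + jk]]; rewrite -{k}jk FibP D'j/= => /eqP qj.
    rewrite -big_filter (perm_big [:: i]) ?big_seq1 ?qj//.
    apply: uniq_perm; rewrite ?filter_uniq// => k; rewrite mem_filter inE.
    rewrite (eq_sym i); have [->|] := eqVneq k i; last by rewrite andbF.
    by rewrite [i \in J0]iJ0 -qj qD.
  rewrite (exchange_big_dep D)/=; last by move=> j i _ /andP[].
  rewrite mulr_sumr big_seq_cond [RHS]big_seq_cond.
  apply: eq_bigr => i /andP[iJ0 Di].
  rewrite (eq_bigl (fun j => D' j && (q j == i))); last by move=> j; rewrite Di.
  rewrite (eq_bigr (fun=> 1 * G i)); last by move=> j _; rewrite mul1r.
  rewrite -mulr_suml cnt// -(FibN i)//; congr (_%:R * _).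
  congr (#|` _ |); apply/fsetIidPr/fsubsetP => j ji.
  by apply/imfset2P; exists i => //; exists j.
rewrite ab (ipZl hip) (ipC hip) ab (ipZl hip) mulrA -expr2.
apply: le_trans (ler_wpM2l (sqr_ge0 _) hJ0) _.
rewrite mulrA ler_pdivrMr; last by rewrite ltr_wpDl// sqr_ge0.
by rewrite [_ * e]mulrC; apply: ler_wpM2l; [exact: ltW|rewrite lerDl].
Qed.

(** The grades [S p] are again orthogonal, and [x] has the right coefficients
    with respect to them, because scalar products with sums can be computed
    termwise; replacing terms by full grades only decreases the error. *)
Lemma has_sum_grades (I : choiceType) (f : I -> V) (g : I -> nat) (i0 : I)
    (x : V) (S : nat -> V) :
  orthogonal_family predT f -> has_sum predT f x ->
  (forall p, has_sum (fun i => g i == p) f (S p)) ->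
  (forall i, (g i == 0) = (i == i0)) ->
  has_sum (fun p => (0 < p)%N) S (x - f i0).
Proof.
move=> ho hx hS g0.
have hop p : orthogonal_family (fun i => g i == p) f.
  by move=> i j _ _; exact: ho.
have Sf p i : ip (S p) (f i) = if g i == p then ip (f i) (f i) else 0.
  case: ifPn => [|gi]; first exact: (orthogonal_has_sum_ip (hop p) (hS p)).
  apply: (has_sum_ip (J0 := fset0) (hS p)) => J _.
  rewrite (ip_suml hip) big1// => j /eqP gj; apply: ho => //.
  by apply: contraNneq gi => <-; rewrite gj.
have SS p q : p != q -> ip (S p) (S q) = 0.
  move=> pq; apply: (has_sum_ip (J0 := fset0) (hS p)) => J _.
  rewrite (ip_suml hip) big1// => j /eqP gj.
  by rewrite (ipC hip) Sf gj (negbTE pq).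
have xS p : ip x (S p) = ip (S p) (S p).
  apply/eqP; rewrite -subr_eq0 -(ipBl hip) (ipC hip); apply/eqP.
  apply: (has_sum_ip (J0 := fset0) (hS p)) => J _.
  rewrite (ip_suml hip) big1// => j /eqP gj; rewrite (ipC hip) (ipBl hip) Sf.
  by rewrite gj eqxx (orthogonal_has_sum_ip ho hx)// subrr.
have hoS : orthogonal_family (fun p => (0 < p)%N) S.
  by move=> p q _ _; exact: SS.
have xfS p : (0 < p)%N -> ip (x - f i0) (S p) = ip (S p) (S p).
  move=> p0; rewrite (ipBl hip) xS (ipC hip (f i0)) Sf.
  have /eqP -> : g i0 == 0 by rewrite g0.
  by rewrite eq_sym gtn_eqF// subr0.
apply: orthogonal_has_sum => // e /hx[J0 hJ0].
pose J1 := (i0 |` J0)%fset; pose J := [fset g i | i in J1]%fset.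
exists J; apply: le_trans (hJ0 J1 (fsubsetUr _ _)).
set A := x - _ - _; set B := x - _.
(* A completes the terms of B to full grades; the correction W is orthogonal
   to A, so A is at most as long as B *)
pose W := f i0 + \sum_(p <- J | (0 < p)%N) S p - \sum_(i <- J1) f i.
have BAW : B = A + W by rewrite /B /A /W -[x - _ - _]addrA -opprD addrA subrK.
have AS p : p \in J -> (0 < p)%N -> ip A (S p) = 0.
  by move=> pJ p0; rewrite (ipBl hip) xfS// orthogonal_ip_sum// subrr.
have Af i : i \in J1 -> ip A (f i) = 0.
  move=> iJ; rewrite 2!(ipBl hip) (orthogonal_has_sum_ip ho hx)//.
  rewrite (ip_suml hip); have [->|ii0] := eqVneq i i0.
    rewrite subrr big1 ?subr0// => p p0; rewrite Sf.
    have /eqP -> : g i0 == 0 by rewrite g0.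
    by rewrite eq_sym gtn_eqF.
  have gi0 : (0 < g i)%N by rewrite lt0n g0.
  rewrite (ho i0) 1?eq_sym// subr0.
  rewrite (big_rem (g i))/=; last by apply/imfsetP; exists i.
  rewrite gi0 Sf eqxx big_seq_cond big1 ?addr0 ?subrr// => p /andP[].
  by rewrite (mem_rem_uniq _ (fset_uniq J)) inE Sf eq_sym => /andP[/negbTE ->].
have AW : ip A W = 0.
  rewrite (ipBr hip) (ipDr hip) !(ip_sumr hip) Af ?fset1U1// add0r.
  rewrite big_seq_cond big1 ?sub0r; last by move=> p /andP[]; exact: AS.
  by rewrite big_seq big1 ?oppr0.
rewrite BAW; move: A W AW {BAW AS Af} => A W AW.
by rewrite (ipDl hip) !(ipDr hip) (ipC hip W A) AW add0r addr0 lerDl ip_ge0.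
Qed.

Lemma has_sum_weq (I : choiceType) (D : pred I) (f : I -> V) s s' :
  weq s s' -> has_sum D f s -> has_sum D f s'.
Proof.
move=> ss' hs e /hs[J0 hJ]; exists J0 => J /hJ; set t := \sum_(_ <- _ | _) _.
by rewrite !(ipBl hip) !(ipBr hip) !(ipC hip t) !ss' !(ipC hip s') !ss'.
Qed.

End has_sum_theory.

(** * Moebius inversion on finite sets *)

Lemma fset_of_seq (K : choiceType) (s : seq K) (M : {fset K}) :
  s =i M -> [fset k in s]%fset = M.
Proof. by move=> sM; apply/fsetP => k; rewrite inE; exact: sM. Qed.

Lemma fset_U1_ind (K : choiceType) (Q : {fset K} -> Prop) :
  Q fset0 -> (forall k M, k \notin M -> Q M -> Q (k |` M)%fset) ->
  forall M, Q M.
Proof.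
move=> Q0 QU M.
suff h s : uniq s -> Q [fset k in s]%fset.
  by have := h _ (fset_uniq M); rewrite (@fset_of_seq _ (enum_fset M) M).
elim: s => [_|k s ih /= /andP[ks us]].
  by rewrite fset_nil.
by rewrite fset_cons; apply: QU; [rewrite inE|exact: ih].
Qed.

Section moebius.
Context (R : realType) (K : choiceType) (V : lmodType R).
Implicit Types (phi : {fset K} -> V) (M : {fset K}).

Definition moebius phi M : V :=
  \sum_(L <- fpowerset M) (-1) ^+ (#|` M| - #|` L|) *: phi L.

Lemma sum_fpowersetU1 (G : {fset K} -> V) k M : k \notin M ->
  \sum_(L <- fpowerset (k |` M)%fset) G L =
  \sum_(L <- fpowerset M) (G L + G (k |` L)%fset).
Proof.
move=> kM; rewrite big_split/=.
rewrite -[X in _ + X](big_map (fun L => k |` L)%fset predT G) -big_cat/=.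
have notk L : L \in fpowerset M -> k \notin L.
  by rewrite fpowersetE => /fsubsetP LM; apply: contra kM; exact: LM.
apply: perm_big; apply: uniq_perm; first exact: fset_uniq.
  rewrite cat_uniq fset_uniq map_inj_in_uniq ?fset_uniq ?andbT/=.
    by apply/hasPn => _ /mapP[L _ ->]; apply/negP => /notk; rewrite fset1U1.
  move=> L L' /notk kL /notk kL' /(congr1 (fun A => A `\ k)%fset).
  by rewrite !fsetU1K.
move=> L; rewrite mem_cat fpowersetE; apply/idP/orP => [LkM|[|]].
- have [kL|kL] := boolP (k \in L).
    right; apply/mapP; exists (L `\ k)%fset; last by rewrite fsetD1K.
    by rewrite fpowersetE fsubDset.
  left; rewrite fpowersetE; apply/fsubsetP => i iL.
  move/fsubsetP : LkM => /(_ i iL); rewrite !inE => /orP[/eqP ik|//].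
  by rewrite -ik iL in kL.
- by rewrite fpowersetE => /fsubset_trans; apply; exact: fsubsetUr.
- by move=> /mapP[L' + ->]; rewrite fpowersetE => /fsetUS; apply.
Qed.

Lemma moebiusU1 phi k M : k \notin M ->
  moebius phi (k |` M)%fset =
  moebius (fun L => phi (k |` L)%fset) M - moebius phi M.
Proof.
move=> kM; rewrite /moebius sum_fpowersetU1// -sumrB.
rewrite big_seq [RHS]big_seq; apply: eq_bigr => L.
rewrite fpowersetE => LM; have kL : k \notin L.
  by apply: contra kM; move/fsubsetP : LM; apply.
rewrite !cardfsU1 kM kL !add1n subSS subSn ?fsubset_leq_card// exprS.
by rewrite mulN1r scaleNr addrC.
Qed.

(** In the induction step the terms of [L] and [k |` L] add up, by [moebiusU1],
    to the term of [L] for the shifted family [fun L => phi (k |` L)]. *)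
Lemma moebius_inversion phi M : \sum_(L <- fpowerset M) moebius phi L = phi M.
Proof.
elim/fset_U1_ind: M phi => [|k M kM ih] phi.
  by rewrite /moebius !fpowerset0 !big_seq_fset1 fpowerset0 big_seq_fset1 subnn
    scale1r.
rewrite sum_fpowersetU1// -(ih (fun L => phi (k |` L)%fset)).
rewrite big_seq [RHS]big_seq; apply: eq_bigr => L.
rewrite fpowersetE => LM; have kL : k \notin L.
  by apply: contra kM; move/fsubsetP : LM; apply.
by rewrite moebiusU1// addrC subrK.
Qed.

End moebius.

(** * Hoeffding components for a commuting family of projections *)

Section hoeffding.
Context (R : realType) (V : lmodType R) (ip : V -> V -> R).
Context (hip : semi_inner ip) (E : set nat -> V -> V).
Context (Esym : forall K x y, ip (E K x) y = ip x (E K y)).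
Context (EI : forall K L x y, ip (E K (E L x)) y = ip (E (K `&` L) x) y).
Local Notation weq := (weq ip).
Local Notation has_sum := (has_sum ip).
Implicit Types (x y z : V) (M : {fset nat}).

Definition differences (s : seq nat) x :=
  foldr (fun k y => y - E [set j | j != k] y) x s.

Definition component x M := moebius (fun L => E [set` L] x) M.

Lemma ip_component x M y : ip (component x M) y =
  moebius (fun L => ip (E [set` L] x) y : R^o) M.
Proof.
rewrite /component /moebius (ip_suml hip).
by apply: eq_bigr => L _; rewrite (ipZl hip).
Qed.

(** Applying [D_k] and then the projection onto a set containing [k] takes the
    difference between keeping and removing [k], which is the recursion
    [moebiusU1] of the alternating sums. *)
Lemma ip_differences s x y (K : {fset nat}) : uniq s ->
  (forall k, k \in s -> k \notin K) ->
  ip (differences s x) (E [set` ([fset k in s] `|` K)%fset] y) =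
  moebius (fun L => ip (E [set` (L `|` K)%fset] x) y : R^o) [fset k in s]%fset.
Proof.
elim: s K => [|k s ih] K /=.
  move=> _ _; rewrite fset_nil /moebius fpowerset0 big_seq_fset1 subnn scale1r.
  by rewrite Esym.
move=> /andP[ks us] sK; have kK := sK k (mem_head _ _).
have {}sK i : i \in s -> i \notin K.
  by move=> iM; apply: sK; rewrite inE iM orbT.
rewrite (ipBl hip) Esym (ipC hip _ (E _ (E _ _))) EI.
rewrite (ipC hip _ (differences _ _)).
rewrite fset_cons moebiusU1; last by rewrite inE.
congr (_ - _).
- rewrite -fsetUA fsetUCA ih// => [|i iM].
    by apply: eq_bigr => L _; rewrite fsetUCA fsetUA.
  rewrite !inE negb_or sK// andbT; apply: contraNneq ks => <-.
  exact: iM.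
- rewrite -ih//; congr (ip _ (E _ _)).
  apply/seteqP; split => i /=; rewrite !inE.
    by move=> [/negbTE ->].
  move=> isK; split; last by case/orP : isK => ->; rewrite ?orbT.
  apply: contraTneq isK => ->; rewrite negb_or kK andbT.
  by rewrite ks.
Qed.

Lemma component_differences x s : uniq s ->
  weq (component x [fset k in s]%fset)
      (E [set` [fset k in s]%fset] (differences s x)).
Proof.
move=> us y; rewrite ip_component Esym -[X in [set` X]]fsetU0 ip_differences//.
by apply: eq_bigr => L _; rewrite fsetU0.
Qed.

(** List [M] with a point [k] outside [K] first: the component is the projection
    of some [w - E_(~ k) w], and [E_K E_M] does not see [E_(~ k)]. *)
Lemma component_vanish x y M (K : set nat) : ~ ([set` M] `<=` K) ->
  ip (component x M) (E K y) = 0.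
Proof.
move=> /existsNP[k /not_implyP[/= kM kK]].
rewrite -(@fset_of_seq _ (k :: enum_fset (M `\ k)%fset) M); last first.
  by move=> i; rewrite -[in RHS](fsetD1K kM) !inE.
rewrite component_differences; last by rewrite /= fset_uniq !inE eqxx.
rewrite Esym/= (ipBl hip) (Esym [set j | j != k]).
rewrite !(ipC hip (differences _ _)) !EI.
apply/eqP; rewrite subr_eq0; apply/eqP; congr (ip (E _ _) _).
apply/seteqP; split => i /=; last by move=> [[]].
by move=> [iM iK]; do 2!split => //; apply/eqP => ik; apply: kK; rewrite -ik.
Qed.

Lemma component_range x M : exists z, weq (component x M) (E [set` M] z).
Proof.
exists (differences (enum_fset M) x) => y.
have := component_differences x (fset_uniq M) y.
by rewrite (@fset_of_seq _ (enum_fset M) M).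
Qed.

Lemma component_orthogonal x : orthogonal_family ip predT (component x).
Proof.
suff h M M' : ~ ([set` M] `<=` [set` M']) ->
    ip (component x M) (component x M') = 0.
  move=> M M' _ _ MM'.
  have [MsM'|/h//] := pselect ([set` M] `<=` [set` M']).
  rewrite (ipC hip); apply: h => M'sM; case/eqP: MM'.
  by apply/fsetP => i; apply/idP/idP => [/MsM'|/M'sM].
move=> MM'; have [z hz] := component_range x M'.
by rewrite (ipC hip) hz (ipC hip) component_vanish.
Qed.

Lemma ip_component_sum x M y :
  \sum_(L <- fpowerset M) ip (component x L) y = ip (E [set` M] x) y.
Proof.
rewrite -(ip_suml hip) /component; congr (ip _ y).
exact: (moebius_inversion (fun L => E [set` L] x)).
Qed.

(** Here [x] may be replaced by its projection [E_M x], the sum of the components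
    of the subsets of [M], of which the proper ones contribute nothing. *)
Lemma component_ip x M :
  ip x (component x M) = ip (component x M) (component x M).
Proof.
have [z hz] := component_range x M.
transitivity (ip (E [set` M] x) (component x M)).
  rewrite (ipC hip) hz (ipC hip _ (component x M)) hz [RHS](ipC hip) Esym.
  by rewrite -[RHS]Esym EI setIid Esym (ipC hip z).
rewrite -ip_component_sum (big_rem M)/=; last by rewrite fpowersetE.
rewrite big_seq big1 ?addr0// => L.
rewrite (mem_rem_uniq _ (fset_uniq _)) inE => /andP[LM _].
exact: component_orthogonal.
Qed.

Lemma bessel x (J : {fset {fset nat}}) (D : pred {fset nat}) :
  \sum_(M <- J | D M) ip (component x M) (component x M) <= ip x x.
Proof.
have ho : orthogonal_family ip D (component x).
  by move=> M M' _ _; exact: component_orthogonal.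
have := ip_ge0 hip (x - \sum_(M <- J | D M) component x M).
rewrite (ipBl hip) !(ipBr hip) (orthogonal_sq_sum hip J ho).
rewrite (ipC hip _ x) (ip_sumr hip) (eq_bigr _ (fun M _ => component_ip x M)).
lra.
Qed.

Context (C : V -> Prop) (C0 : C 0).
Context (CL : forall a y z, C y -> C z -> C (a *: y + z)).
Context (Cc : sq_complete ip C) (CE : forall K x, C (E K x)).
Context (Ctot : forall z, C z ->
  (forall M y, ip z (E [set` M] y) = 0) -> ip z z = 0).

Lemma component_in x M : C (component x M).
Proof.
rewrite /component /moebius; elim/big_rec : _ => // L y _.
by apply: CL; exact: CE.
Qed.

Lemma component_summable x (D : pred {fset nat}) :
  exists2 s, C s & has_sum D (component x) s.
Proof.
apply: (orthogonal_summable hip C0 CL Cc (K := ip x x)).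
- by move=> M _; exact: component_in.
- by move=> M M' _ _; exact: component_orthogonal.
- by move=> J; exact: bessel.
Qed.

(** The components are summable by Bessel's inequality; the defect of their sum
    is orthogonal to the ranges of all projections onto finite sets. *)
Theorem hoeffding_decomposition x : C x -> has_sum predT (component x) x.
Proof.
move=> Cx; have [s Cs hs] := component_summable x predT.
apply: (has_sum_weq hip _ hs) => y; apply/eqP.
rewrite -subr_eq0 -(ipBl hip); apply/eqP; apply: (ip_null hip); apply: Ctot.
  by rewrite addrC -scaleN1r; exact: CL.
move=> M z; rewrite (ipBl hip); apply/eqP; rewrite subr_eq0; apply/eqP.
apply: (has_sum_ip hip (J0 := fpowerset M) hs) => J MJ.
rewrite (ip_suml hip) (bigID (fun L => L \in fpowerset M))/=.
rewrite [X in _ + X]big1 ?addr0; last first.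
  move=> L LM; apply: component_vanish => LM'; move/negP: LM; apply.
  by rewrite fpowersetE; apply/fsubsetP => i; exact: LM'.
rewrite -(big_fsubset predT _ MJ) ip_component_sum.
by rewrite Esym (ipC hip) EI setIid (ipC hip).
Qed.


(** The increasing tuples and the tuples without repetition are both given by a
    class [D] of sequences and, for each [M], the list [l M] of the sequences of
    [D] with underlying set [M]. *)
Lemma has_sum_tuples (p N : nat) (l : {fset nat} -> seq (seq nat))
    (D : pred (seq nat)) x y :
  (forall s, D s -> uniq s) ->
  (forall M s, (s \in l M) = D s && ([fset k in s]%fset == M)) ->
  (forall M, uniq (l M)) ->
  (forall M, #|` M| = p -> size (l M) = N) ->
  has_sum (fun M => #|` M| == p) (component x) y ->
  has_sum (fun i : p.-tuple nat => D i)
    (fun i => E [set` i] (differences i x)) (N%:R *: y).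
Proof.
move=> Du lP lu lN; pose q (i : p.-tuple nat) := [fset k in tval i]%fset.
pose Fib M : {fset p.-tuple nat} := [fset i in pmap insub (l M)]%fset.
have Fib_uniq M : uniq (pmap insub (l M) : seq (p.-tuple nat)).
  exact: pmap_sub_uniq.
have card_q (s : seq nat) : D s -> #|` [fset k in s]%fset| = size s.
  by move=> Ds; rewrite card_fseq undup_id// Du.
apply: (has_sum_fibres hip (q := q) (Fib := Fib)).
- by move=> i Di; rewrite card_q// size_tuple.
- by move=> M i; rewrite inE/= mem_pmap_sub/= lP.
- move=> M /eqP Mp; rewrite -(lN M)// card_fseq undup_id// size_pmap_sub.
  apply/eqP; rewrite -all_count; apply/allP => s /=.
  by rewrite lP => /andP[Ds /eqP sM]; rewrite -card_q// sM Mp.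
- move=> i Di z; rewrite /q component_differences ?Du//.
  by congr (ip (E _ _) z); apply/seteqP; split => k /=; rewrite inE.
- by move=> M M' _ _; exact: component_orthogonal.
Qed.

(** The term [p = 0], which is [E set0 x], is the one that [has_sum_grades] splits
    off. *)
Theorem chaos_expansion x : C x -> exists S : nat -> V,
  [/\ forall p, has_sum (fun i : p.-tuple nat => sorted ltn i)
        (fun i => E [set` i] (differences i x)) (S p),
      forall p, has_sum (fun i : p.-tuple nat => uniq i)
        (fun i => E [set` i] (differences i x)) (p`!%:R *: S p) &
      has_sum (fun p => (0 < p)%N) S (x - E set0 x)].
Proof.
move=> Cx.
have /choice[S hS] : forall p, exists y,
    has_sum (fun M => #|` M| == p) (component x) y.
  move=> p; have [y _ hy] := component_summable x (fun M => #|` M| == p).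
  by exists y.
have sort_ltn M : sorted ltn (sort leq M).
  by rewrite ltn_sorted_uniq_leq sort_uniq fset_uniq (sort_sorted leq_total).
exists S; split.
- move=> p; rewrite -[S p]scale1r.
  apply: (has_sum_tuples (N := 1) (D := sorted ltn)
    (l := fun M => [:: sort leq M]) _ _ _ _ (hS p)) => //.
  + by move=> s; exact: (sorted_uniq ltn_trans ltnn).
  + move=> M s; rewrite inE; apply/eqP/andP => [->|[ss /eqP <-]].
      split; last by apply/eqP/fset_of_seq => k; rewrite mem_sort.
      exact: sort_ltn.
    apply: (irr_sorted_eq ltn_trans ltnn) => //.
    by move=> k; rewrite mem_sort inE.
- move=> p.
  apply: (has_sum_tuples (D := uniq)
    (l := fun M => permutations M) _ _ _ _ (hS p)) => //.
  + move=> M s; rewrite mem_permutations; apply/idP/andP => [sM|[us /eqP <-]].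
      split; first by rewrite (perm_uniq sM) fset_uniq.
      by apply/eqP/fset_of_seq => k; rewrite (perm_mem sM).
    by apply: uniq_perm; [|exact: fset_uniq|move=> k; rewrite inE].
  + by move=> M; exact: permutations_uniq.
  + by move=> M <-; rewrite size_permutations ?fset_uniq.
have -> : E set0 x = component x fset0.
  rewrite /component /moebius fpowerset0 big_seq_fset1 subnn scale1r.
  by congr (E _ x); apply/seteqP; split.
apply: (has_sum_grades hip _ (hoeffding_decomposition Cx) hS).
  exact: component_orthogonal.
by move=> M; rewrite cardfs_eq0.
Qed.

End hoeffding.

(** * The space of square-integrable functions *)

Section L2_space.
Context d (T : measurableType d) (R : realType) (P : probability T R).

Definition L2 := LfunType P (lee1n 2 : (1 <= 2%:E :> \bar R)%E).

Definition inner (f g : L2) : R := \int[P]_x (f x * g x).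

Lemma L2_addE (f g : L2) x : (f + g) x = f x + g x. Proof. by []. Qed.
Lemma L2_scaleE a (f : L2) x : (a *: f) x = a * f x. Proof. by []. Qed.
Lemma L2_oppE (f : L2) x : (- f) x = - f x. Proof. by []. Qed.

Lemma inner_integrable (f g : L2) :
  P.-integrable setT (EFin \o (fun x => f x * g x)).
Proof. by apply/Lfun1_integrable; apply: Lfun2_mul_Lfun1; exact: LfunP. Qed.

Lemma inner_semi_inner : semi_inner inner.
Proof.
split=> [f g h|a f h|f g|f].
- rewrite /inner -RintegralD//; try exact: inner_integrable.
  by apply: eq_Rintegral => x _; rewrite L2_addE mulrDl.
- rewrite /inner -RintegralZl//; last exact: inner_integrable.
  by apply: eq_Rintegral => x _; rewrite L2_scaleE mulrA.
- by apply: eq_Rintegral => x _; rewrite mulrC.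
- by apply: Rintegral_ge0 => x _; rewrite -expr2 sqr_ge0.
Qed.

Lemma inner_integralE (f : L2) :
  (inner f f)%:E = (\int[P]_x ((f x) ^+ 2)%:E)%E.
Proof.
rewrite /inner /Rintegral fineK; last first.
  exact: (integrable_fin_num _ (inner_integrable f f)).
by apply: eq_integral => x _; rewrite expr2.
Qed.

Lemma Lnorm2E (f : L2) :
  ('N[P]_2%:E[EFin \o f] = (Num.sqrt (inner f f))%:E)%E.
Proof.
rewrite unlock -powR12_sqrt ?(ip_ge0 inner_semi_inner)// -poweR_EFin.
congr (_ `^ _)%E; rewrite inner_integralE; apply: eq_integral => x _ /=.
by rewrite powR_mulrn// real_normK ?num_real.
Qed.

Lemma measurable_L2 (f : L2) : measurable_fun setT (f : T -> R).
Proof. exact: measurable_funPT. Qed.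

Lemma measurable_L2_sqr (f : L2) :
  measurable_fun setT (EFin \o (fun x => (f x) ^+ 2 : R)).
Proof.
by apply/measurable_EFinP; apply: measurable_funX; exact: measurable_L2.
Qed.

Lemma Lfun2P (f : T -> R) : measurable_fun setT f ->
  (\int[P]_x ((f x) ^+ 2)%:E < +oo)%E -> f \in Lfun P 2%:E.
Proof.
move=> mf fi; rewrite inE; apply/andP; split; rewrite inE//=.
rewrite /finite_norm unlock /= poweR_lty//.
under eq_integral do rewrite powR_mulrn// real_normK ?num_real//.
exact: fi.
Qed.

(** Applied to the differences [v k - u n] of a Cauchy sequence, this shows both
    that an almost sure limit is square-integrable and that the convergence
    takes place in norm. *)
Lemma fatou_L2 (f : T -> R) (w : nat -> L2) (e : R) K :
  measurable_fun setT f ->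
  (\forall x \ae P, w ^~ x @ \oo --> f x) ->
  (forall k, (K <= k)%N -> inner (w k) (w k) <= e) ->
  (\int[P]_x ((f x) ^+ 2)%:E <= e%:E)%E.
Proof.
move=> mf wf we.
have mw k : measurable_fun setT (EFin \o (fun x => (w k x) ^+ 2 : R)).
  by apply/measurable_EFinP; apply: measurable_funX; exact: measurable_L2.
have w0 k x : (0 <= ((w k x) ^+ 2)%:E)%E by rewrite lee_fin sqr_ge0.
have -> : (\int[P]_x ((f x) ^+ 2)%:E =
    \int[P]_x limn_einf (fun k => ((w k x) ^+ 2)%:E))%E.
  apply: ge0_ae_eq_integral => //.
  - by apply/measurable_EFinP; exact: measurable_funX.
  - rewrite (_ : (fun _ => _) = (fun x =>
        - limn_esup (fun k => - ((w k x) ^+ 2)%:E))%E); last first.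
      apply/funext => x; rewrite -[LHS]oppeK; congr (- _)%E.
      by rewrite -limn_esupN.
    apply: measurableT_comp => //; apply: measurable_fun_limn_esup => k.
    exact: measurableT_comp (mw k).
  - by move=> x _; rewrite lee_fin sqr_ge0.
  - move=> x _; rewrite limn_einf_lim; apply: lime_ge.
      exact: is_cvg_einfs.
    by apply: nearW => n; apply: le_ereal_inf_tmp => _ [k _ <-].
  apply: filterS wf => x wx _; apply/esym.
  have /cvg_limn_einf_sup[-> _]// :
      (fun k => ((w k x) ^+ 2)%:E) @ \oo --> ((f x) ^+ 2)%:E.
  apply: cvg_EFin; first exact: nearW.
  by rewrite expr2; under eq_fun do rewrite expr2; exact: cvgM.
apply: le_trans (fatou P measurableT mw (fun k x _ => w0 k x)) _.
rewrite limn_einf_lim; apply: lime_le; first exact: is_cvg_einfs.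
apply: nearW => n.
apply: (@le_trans _ _ (\int[P]_x ((w (maxn n K) x) ^+ 2)%:E)%E).
  by apply: ereal_inf_lbound; exists (maxn n K) => //=; rewrite leq_maxl.
by rewrite -inner_integralE lee_fin we// leq_maxr.
Qed.



Definition sub_measurable (G : set_system T) (f : T -> R) :=
  measurable_fun [set: g_sigma_algebraType G] (f : g_sigma_algebraType G -> R).

Lemma sub_measurable_fun G f : G `<=` measurable -> sub_measurable G f ->
  measurable_fun setT f.
Proof.
move=> Gm mf _ B mB; have := mf measurableT B mB; rewrite !setTI.
exact: (smallest_sub (sigma_algebra_measurable T) Gm).
Qed.

(** If the squared increments decay like [c k ^+ 2] with [c] summable, then
    [2 |a k| <= a k ^+ 2 / c k + c k] bounds the increments [a k] by terms with
    summable integrals. *)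
Lemma fast_cauchy_ae_cvg (v : nat -> L2) :
  (forall k, inner (v k.+1 - v k) (v k.+1 - v k) <= ((2 ^ k.+1)%:R^-1) ^+ 2) ->
  \forall x \ae P, cvgn (fun k => v k x).
Proof.
move=> hv; pose c k : R := (2 ^ k.+1)%:R^-1.
have c0 k : 0 < c k by rewrite invr_gt0 ltr0n expn_gt0.
have [w wE] : exists w : nat -> L2, forall k, w k = v k.+1 - v k.
  by exists (fun k => v k.+1 - v k).
have cge0 k : 0 <= c k by exact: ltW.
pose h k x : R := (c k)^-1 * (w k x) ^+ 2 + c k.
have h0 k x : 0 <= h k x.
  by rewrite addr_ge0// mulr_ge0 ?invr_ge0// sqr_ge0.
have mh k : measurable_fun setT (EFin \o h k).
  apply/measurable_EFinP; apply: measurable_funD => //.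
  apply: measurable_funM => //; apply: measurable_funX; exact: measurable_L2.
have ih k : (\int[P]_x (h k x)%:E <= (2 / (2 ^ k.+1)%:R)%:E)%E.
  rewrite /h; under eq_integral do rewrite EFinD.
  rewrite ge0_integralD//; last 3 first.
  - by move=> x _; rewrite lee_fin mulr_ge0 ?invr_ge0// sqr_ge0.
  - apply/measurable_EFinP; apply: measurable_funM => //.
    by apply: measurable_funX; exact: measurable_L2.
  - by move=> x _; rewrite lee_fin.
  rewrite integral_cst//= probability_setT mule1.
  under eq_integral do rewrite EFinM.
  rewrite ge0_integralZl//; last 3 first.
  - exact: (measurable_L2_sqr (w k)).
  - by move=> x _; rewrite lee_fin sqr_ge0.
  - by rewrite lee_fin invr_ge0.
  rewrite -inner_integralE -EFinM -EFinD lee_fin -/(c k).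
  have -> : 2 * c k = c k + c k by ring.
  rewrite lerD2r mulrC ler_pdivrMr// -expr2 wE; exact: hv.
have sum_fin : (\int[P]_x \sum_(k <oo) (h k x)%:E < +oo)%E.
  rewrite integral_nneseries//; last by move=> n x _; rewrite lee_fin.
  apply: (@le_lt_trans _ _ 2%:E); last exact: ltry.
  apply: le_trans (epsilon_trick0 xpredT _) => //.
  apply: lee_nneseries => // k _ _.
  by apply: integral_ge0 => x _; rewrite lee_fin.
have sum0 x : (0 <= \sum_(k <oo) (h k x)%:E)%E.
  by apply: nneseries_ge0 => k _ _; rewrite lee_fin.
have : P.-integrable setT (fun x => \sum_(k <oo) (h k x)%:E)%E.
  apply/integrableP; split.
    apply: (@ge0_emeasurable_sum _ _ _ _ (fun k => EFin \o h k) xpredT).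
      by move=> k x _ _; rewrite lee_fin.
    by move=> k _; exact: mh.
  by under eq_integral do rewrite gee0_abs//.
move=> /(integrable_ae measurableT); apply: filterS => x /(_ I) hx.
pose a k : R := v k.+1 x - v k x.
have ah k : `|a k| <= h k x.
  have : 0 <= (c k)^-1 * (`|a k| - c k) ^+ 2.
    by rewrite mulr_ge0 ?sqr_ge0// invr_ge0 ltW.
  rewrite /h -(real_normK (num_real (w k x))) wE -/(a k).
  rewrite (_ : _ * _ = (c k)^-1 * `|a k| ^+ 2 + c k - 2 * `|a k|); last first.
    by field; rewrite gt_eqF.
  have := normr_ge0 (a k); lra.
have : cvgn [normed series a].
  apply: nondecreasing_is_cvgn.
    by apply: nondecreasing_series => k _ _; exact: normr_ge0.
  exists (fine (\sum_(k <oo) (h k x)%:E)%E) => _ [n _ <-].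
  rewrite -lee_fin fineK// /series/= -sumEFin.
  apply: le_trans (nneseries_lim_ge n _); last by move=> k _ _; rewrite lee_fin.
  by apply: lee_sum => k _; rewrite lee_fin.
move=> /normed_cvg.
rewrite (_ : a = telescope (fun k => v k x))// telescopeK => ca.
rewrite (_ : (fun k => v k x) = (fun k => (v k x - v 0 x) + v 0 x)).
  by apply: is_cvgD => //; exact: is_cvg_cst.
by apply/funext => k; rewrite subrK.
Qed.

(** The limit is the pointwise limit of a rapidly convergent subsequence, taken
    as a limit superior so that it is measurable for [G] and not just almost
    surely equal to such a function. *)
Lemma L2_complete (G : set_system T) : G `<=` measurable ->
  sq_complete inner (fun f : L2 => sub_measurable G f).
Proof.
move=> Gm u mu cu.
have /choice[N hN] : forall k, exists N, forall m n, (N <= m)%N -> (m <= n)%N ->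
    inner (u n - u m) (u n - u m) <= ((2 ^ k.+1)%:R^-1) ^+ 2.
  by move=> k; apply: cu; rewrite exprn_gt0// invr_gt0 ltr0n expn_gt0.
(* phi k >= k makes the Cauchy bound on u valid along the subsequence *)
pose phi := fix phi k := if k is k'.+1 then maxn (phi k').+1 (N k) else N 0.
have phiN k : (N k <= phi k)%N by case: k => //= k; rewrite leq_maxr.
have phik k : (k <= phi k)%N.
  by elim: k => //= k ih; rewrite leq_max ltnS ih.
pose v k := u (phi k).
have /fast_cauchy_ae_cvg vcvg k :
    inner (v k.+1 - v k) (v k.+1 - v k) <= ((2 ^ k.+1)%:R^-1) ^+ 2.
  by apply: hN => //=; rewrite leq_max leqnSn.
pose f x := fine (limn_esup (fun k => (v k x)%:E)).
have Gf : sub_measurable G f.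
  apply: measurableT_comp => //; apply: measurable_fun_limn_esup => k.
  by apply/measurable_EFinP; exact: mu.
have mf := sub_measurable_fun Gm Gf.
have vf : \forall x \ae P, v ^~ x @ \oo --> f x.
  apply: filterS vcvg => x /cvg_ex[l vl].
  have /cvg_limn_einf_sup[_ fl] : (fun k => (v k x)%:E) @ \oo --> l%:E.
    by apply: cvg_EFin; [exact: nearW|exact: vl].
  by rewrite /f fl.
have uf e n K : (forall k, (K <= k)%N -> inner (v k - u n) (v k - u n) <= e) ->
    (\int[P]_x ((f x - u n x) ^+ 2)%:E <= e%:E)%E.
  apply: (@fatou_L2 (fun x => f x - u n x) (fun k => v k - u n)).
    by apply: measurable_funB => //; exact: measurable_L2.
  by apply: filterS vf => x vx; apply: cvgB => //; exact: cvg_cst.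
have uve e : 0 < e -> exists K, forall n, (K <= n)%N ->
    (\int[P]_x ((f x - u n x) ^+ 2)%:E <= e%:E)%E.
  move=> /cu[K hK]; exists K => n Kn; apply: (uf _ _ n) => k nk.
  by apply: hK => //; apply: leq_trans nk (phik k).
have [K /(_ K (leqnn _)) hK] := uve 1 ltr01.
have f2 : (fun x => f x - u K x) \in Lfun P 2%:E.
  apply: Lfun2P; first by apply: measurable_funB => //; exact: measurable_L2.
  exact: le_lt_trans hK (ltry _).
pose g : L2 := Lfun_Sub (lee1n 2) f2.
have gf : (g + u K : T -> R) = f by apply/funext => x; rewrite L2_addE subrK.
exists (g + u K); first by rewrite gf.
move=> e /uve[M hM]; exists M => n /hM.
rewrite -lee_fin inner_integralE; apply: le_trans.
rewrite le_eqVlt; apply/orP; left; apply/eqP; apply: eq_integral => x _.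
by rewrite -gf -sqrrN opprB.
Qed.



Lemma inner_ae (f g h : L2) : (f : T -> R) = g %[ae P] ->
  inner f h = inner g h.
Proof.
move=> fg; rewrite /inner /Rintegral; congr fine.
apply: ae_eq_integral => //.
- exact: (measurable_int _ (inner_integrable f h)).
- exact: (measurable_int _ (inner_integrable g h)).
- by apply: filterS fg => x /= + _ => ->.
Qed.

Lemma ae_of_inner (f g : L2) : weq inner f g -> (f : T -> R) = g %[ae P].
Proof.
move=> fg; have [w wE] : exists w : L2, w = f - g by exists (f - g).
have w0 : inner w w = 0 by rewrite {1}wE (ipBl inner_semi_inner) fg subrr.
have : (\int[P]_x `|((w x) ^+ 2)%:E| = 0)%E.
  rewrite -[0%E]/(0%:E) -w0 inner_integralE; apply: eq_integral => x _.
  by rewrite gee0_abs// lee_fin sqr_ge0.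
move=> /(ae_eq_integral_abs P measurableT (measurable_L2_sqr w)).
apply: filterS => x + _ => /(_ I)[/eqP].
by rewrite sqrf_eq0 wE L2_addE L2_oppE subr_eq0 => /eqP.
Qed.

Lemma cst_L2_subproof (c : R) : cst c \in Lfun P 2%:E.
Proof. exact: Lfun_cst. Qed.

Definition cst_L2 (c : R) : L2 := Lfun_Sub (lee1n 2) (cst_L2_subproof c).

Lemma L2_integrable (f : L2) : P.-integrable setT (EFin \o f).
Proof.
by have := inner_integrable f (cst_L2 1); under eq_fun do rewrite /= mulr1.
Qed.

Lemma indic_L2_subproof (f : L2) A : measurable A ->
  (fun x => f x * \1_A x) \in Lfun P 2%:E.
Proof.
move=> mA; apply: Lfun2P.
  by apply: measurable_funM; [exact: measurable_L2|exact: measurable_indic].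
apply: (@le_lt_trans _ _ (\int[P]_x ((f x) ^+ 2)%:E)%E); last first.
  by rewrite -inner_integralE ltry.
apply: ge0_le_integral => //.
- by move=> x _; rewrite lee_fin sqr_ge0.
- apply/measurable_EFinP; apply: measurable_funX; apply: measurable_funM.
    exact: measurable_L2.
  exact: measurable_indic.
- exact: measurable_L2_sqr.
- move=> x _; rewrite lee_fin exprMn indicE -natrX.
  by case: (_ \in _); rewrite ?mulr1// mulr0 sqr_ge0.
Qed.

Definition cut (f : L2) A (mA : measurable A) : L2 :=
  Lfun_Sub (lee1n 2) (indic_L2_subproof f mA).

Lemma inner_cut (f g : L2) A (mA : measurable A) :
  inner (cut f mA) g = \int[P]_(x in A) (f x * g x).
Proof.
rewrite Rintegral_mkcond; apply: eq_Rintegral => x _ /=.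
by rewrite patchE indicE; case: ifPn => xA; rewrite ?mulr1// mulr0 mul0r.
Qed.

Lemma inner_cutC (f g : L2) A (mA : measurable A) :
  inner (cut f mA) g = inner f (cut g mA).
Proof.
rewrite [RHS](ipC inner_semi_inner) !inner_cut.
by apply: eq_Rintegral => x _; rewrite mulrC.
Qed.

Lemma inner_cut1 (f : L2) A (mA : measurable A) :
  (inner (cut f mA) (cst_L2 1))%:E = (\int[P]_(x in A) (f x)%:E)%E.
Proof.
rewrite inner_cut /Rintegral fineK; last first.
  apply: integrable_fin_num => //.
  exact: (integrableS measurableT _ _ (inner_integrable f (cst_L2 1))).
by apply: eq_integral => x _; rewrite mulr1.
Qed.

Lemma sub_measurable_cut G (f : L2) A (mA : measurable A) : G A ->
  sub_measurable G f -> sub_measurable G (cut f mA).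
Proof.
move=> GA mf; apply: measurable_funM => //; apply: measurable_indic.
exact: sub_sigma_algebra.
Qed.

Lemma sub_measurable_cst G c : sub_measurable G (cst_L2 c).
Proof. exact: measurable_cst. Qed.

Section conditional_expectation.
Context (G : set_system T) (Gs : sigma_algebra setT G) (Gm : G `<=` measurable).

Lemma sub_measurable_preimage (f : T -> R) B : sub_measurable G f ->
  measurable B -> G (f @^-1` B).
Proof.
move=> mf mB; have := mf measurableT B mB; rewrite setTI.
by rewrite /measurable/= sigma_algebra_id.
Qed.

(** Both [Y >= 0] and [Y < 0] are events of [G], so the integral of [`|Y|]
    vanishes. *)
Lemma ae0_of_integrals (Y : T -> R) : sub_measurable G Y ->
  P.-integrable setT (EFin \o Y) ->
  (forall A, G A -> (\int[P]_(x in A) (Y x)%:E = 0)%E) -> Y = cst 0 %[ae P].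
Proof.
move=> mY iY Y0; pose A := Y @^-1` `[0, +oo[.
have GA : G A by apply: sub_measurable_preimage.
have GcA : G (~` A).
  rewrite /A preimage_setC; apply: sub_measurable_preimage => //.
  exact: measurableC.
have mA := Gm GA.
have h : (\int[P]_x `|(Y x)%:E| = 0)%E.
  have iYn : P.-integrable setT (abse \o (EFin \o Y)) by exact: integrable_abse.
  rewrite -(setvU A) ge0_integral_setU//; last 3 first.
  - exact: measurableC.
  - by rewrite setvU; exact: (measurable_int _ iYn).
  - by apply/disj_setPS; rewrite setICl.
  rewrite (eq_integral (fun x => - (Y x)%:E)%E); last first.
    move=> x; rewrite inE /A/= in_itv/= andbT => /negP; rewrite -ltNge => Yx.
    by rewrite /= ltr0_norm.
  rewrite integralN; last first.
    apply: integrable_add_def; first exact: measurableC.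
    by apply: (integrableS measurableT _ _ iY) => //; exact: measurableC.
  rewrite (Y0 _ GcA) oppe0 add0e -[RHS](Y0 _ GA); apply: eq_integral => x.
  by rewrite inE /A/= in_itv/= andbT => Yx; rewrite /= ger0_norm.
have mY' := measurable_int _ iY.
have /(ae_eq_integral_abs P measurableT mY') := h.
by apply: filterS => x /= h1 _; have [->] := h1 I.
Qed.



Lemma sub_measurable_L2_projection (f : L2) :
  exists2 g : L2, sub_measurable G g &
    forall z : L2, sub_measurable G z -> inner (f - g) z = 0.
Proof.
apply: (projection inner_semi_inner f (C := fun f : L2 => sub_measurable G f)).
- exact: (@sub_measurable_cst G 0).
- move=> a y z my mz; apply: measurable_funD => //.
  by apply: measurable_funM => //; exact: measurable_cst.
- exact: L2_complete.
Qed.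

Lemma is_cond_exp_projection (f g : L2) : sub_measurable G g ->
  (forall z : L2, sub_measurable G z -> inner (f - g) z = 0) ->
  is_cond_exp P G f g.
Proof.
move=> mg fg; split => //; first exact: L2_integrable.
move=> A GA; rewrite -!(inner_cut1 _ (Gm GA)) !inner_cutC.
congr (_%:E); apply/eqP; rewrite eq_sym -subr_eq0; apply/eqP.
rewrite -(ipBl inner_semi_inner); apply: fg.
by apply: sub_measurable_cut => //; exact: sub_measurable_cst.
Qed.

Lemma is_cond_exp_unique (f g h : T -> R) : P.-integrable setT (EFin \o f) ->
  is_cond_exp P G f g -> is_cond_exp P G f h -> g = h %[ae P].
Proof.
move=> fi [mg ig eg] [mh ih eh].
have igh : P.-integrable setT (EFin \o (fun x => g x - h x)).
  exact: (integrableB measurableT ig ih).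
have : (fun x => g x - h x) = cst 0 %[ae P].
  apply: ae0_of_integrals => //; first exact: measurable_funB.
  move=> A GA; have mA := Gm GA; under eq_integral do rewrite EFinB.
  rewrite integralB_EFin//; try by apply: (integrableS measurableT).
  rewrite eg// eh// subee//; apply: integrable_fin_num => //.
  exact: (integrableS measurableT _ _ fi).
by apply: filterS => x + _ => /(_ I)/eqP; rewrite subr_eq0 => /eqP.
Qed.

Lemma cond_exp_ae (f g : L2) : is_cond_exp P G f g ->
  cond_exp P G f = g %[ae P] /\ sub_measurable G (cond_exp P G f).
Proof.
move=> fg; have h : is_cond_exp P G f (cond_exp P G f).
  exact: (xgetPex _ (ex_intro _ _ fg)).
by split; [exact: (is_cond_exp_unique (L2_integrable f))|case: h].
Qed.

(** The orthogonal projection is a version of the conditional expectation, and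
    every other version agrees with it almost surely. *)
Lemma cond_exp_L2_subproof (f : L2) : cond_exp P G f \in Lfun P 2%:E.
Proof.
have [g mg fg] := sub_measurable_L2_projection f.
have [eg mE] := cond_exp_ae (is_cond_exp_projection mg fg).
have mE' := sub_measurable_fun Gm mE.
apply: Lfun2P => //.
rewrite (@ge0_ae_eq_integral _ _ _ P setT _ (fun x => ((g x) ^+ 2)%:E))//.
- by rewrite -inner_integralE ltry.
- by apply/measurable_EFinP; exact: measurable_funX.
- exact: (measurable_L2_sqr g).
- by move=> x _; rewrite lee_fin sqr_ge0.
- by move=> x _; rewrite lee_fin sqr_ge0.
- by apply: filterS eg => x /(_ I) + _ => ->.
Qed.

Definition cond_exp_L2 (f : L2) : L2 :=
  Lfun_Sub (lee1n 2) (cond_exp_L2_subproof f).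

Lemma sub_measurable_cond_exp (f : L2) : sub_measurable G (cond_exp_L2 f).
Proof.
have [g mg fg] := sub_measurable_L2_projection f.
by have [] := cond_exp_ae (is_cond_exp_projection mg fg).
Qed.

Lemma inner_cond_exp (f z : L2) : sub_measurable G z ->
  inner (cond_exp_L2 f) z = inner f z.
Proof.
have [g mg fg] := sub_measurable_L2_projection f.
have [eg _] := cond_exp_ae (is_cond_exp_projection mg fg).
move=> mz; rewrite (inner_ae (g := g))//.
by apply/eqP; rewrite eq_sym -subr_eq0 -(ipBl inner_semi_inner) fg.
Qed.

Lemma inner_cond_expC (f g : L2) :
  inner (cond_exp_L2 f) g = inner f (cond_exp_L2 g).
Proof.
have h := sub_measurable_cond_exp.
transitivity (inner (cond_exp_L2 f) (cond_exp_L2 g)).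
  by rewrite !(ipC inner_semi_inner (cond_exp_L2 f)) [RHS]inner_cond_exp.
by rewrite inner_cond_exp.
Qed.

Lemma cond_exp_id (z : L2) : sub_measurable G z ->
  weq inner (cond_exp_L2 z) z.
Proof.
move=> mz g; rewrite inner_cond_expC (ipC inner_semi_inner) inner_cond_exp//.
by rewrite (ipC inner_semi_inner).
Qed.

Lemma sub_measurable_eq0 (z : L2) : sub_measurable G z ->
  (forall A, G A -> (\int[P]_(x in A) (z x)%:E = 0)%E) ->
  weq inner z 0.
Proof.
move=> mz z0 g; apply: inner_ae.
by have := ae0_of_integrals mz (L2_integrable z) z0.
Qed.

End conditional_expectation.


(** Once the whole space is among them, the sets over which [z] has integral zero
    form a Dynkin system. *)
Lemma pi_lambda_integral (Cyl : set_system T) (z : L2) : setI_closed Cyl ->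
  Cyl `<=` measurable -> Cyl setT ->
  (forall A, Cyl A -> (\int[P]_(x in A) (z x)%:E = 0)%E) ->
  forall A, <<s Cyl >> A -> (\int[P]_(x in A) (z x)%:E = 0)%E.
Proof.
move=> CylI Cylm CylT z0.
have iz A : measurable A -> P.-integrable A (EFin \o z).
  by move=> mA; apply: (integrableS measurableT _ _ (L2_integrable z)).
pose D := [set A | measurable A /\ (\int[P]_(x in A) (z x)%:E = 0)%E].
suff h : <<s Cyl >> `<=` D by move=> A /h[].
rewrite -setI_closed_g_dynkin_g_sigma_algebra//.
apply: smallest_sub; last by move=> A CA; split; [exact: Cylm|exact: z0].
split.
- by split => //; exact: z0.
- move=> A [mA zA]; have mcA := measurableC mA; split => //.
  have := z0 _ CylT; rewrite -(setvU A) integral_setU//; last 2 first.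
    by apply: (measurable_int P); apply: iz; exact: measurableU.
    by apply/disj_setPS; rewrite setICl.
  by rewrite zA adde0.
- move=> S tS DS; have mS : measurable (\bigcup_k S k).
    by apply: bigcup_measurable => k _; have [] := DS k.
  split => //; rewrite integral_bigcup//; last 2 first.
    by move=> k; have [] := DS k.
    exact: iz.
  by apply: eseries0 => k _ _; have [] := DS k.
Qed.

Lemma sub_measurable_mono G G' (f : T -> R) : G `<=` G' ->
  sub_measurable G f -> sub_measurable G' f.
Proof.
move=> GG' mf _ B mB; have := mf measurableT B mB.
by apply: sub_smallest2r.
Qed.

(** A function is orthogonal to the whole space [L^2(G)] once its integrals over
    the sets of [G] vanish: its projection onto that space is then null. *)
Lemma inner_eq0_of_integrals (G : set_system T) (w z : L2) :
  sigma_algebra setT G -> G `<=` measurable ->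
  (forall A, G A -> (\int[P]_(x in A) (w x)%:E = 0)%E) ->
  sub_measurable G z -> inner w z = 0.
Proof.
move=> Gs Gm w0 mz; rewrite -(inner_cond_exp Gs Gm _ mz).
rewrite (sub_measurable_eq0 Gs Gm)//.
- by rewrite (ip0l inner_semi_inner).
- exact: sub_measurable_cond_exp.
- move=> A GA; rewrite -(w0 A GA) -!(inner_cut1 _ (Gm A GA)) !inner_cutC.
  rewrite inner_cond_exp//; apply: sub_measurable_cut => //.
  exact: sub_measurable_cst.
Qed.

Definition indic_L2 A (mA : measurable A) : L2 := cut (cst_L2 1) mA.

Lemma integral_indicE (f : L2) A (mA : measurable A) :
  (\int[P]_(x in A) (f x)%:E)%E = (inner f (indic_L2 mA))%:E.
Proof. by rewrite -inner_cutC inner_cut1. Qed.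

Lemma inner_indic A B (mA : measurable A) (mB : measurable B) :
  inner (indic_L2 mA) (indic_L2 mB) = fine (P (A `&` B)).
Proof.
rewrite /indic_L2 inner_cut /Rintegral setIC -(integral_indic P mA mB).
by congr fine; apply: eq_integral => x _; rewrite /= !mul1r.
Qed.

Lemma inner_cst_indic c A (mA : measurable A) :
  inner (cst_L2 c) (indic_L2 mA) = c * fine (P A).
Proof.
rewrite (ipC inner_semi_inner) inner_cut -Rintegral_cst//.
by apply: eq_Rintegral => x _; rewrite /= mul1r.
Qed.

End L2_space.

(** * Sigma-algebras generated by independent random variables *)

Section independence.
Context d (T : measurableType d) (R : realType) (P : probability T R).
Context (dE : nat -> measure_display) (E : forall n, measurableType (dE n)).
Context (X : forall n, {RV P >-> E n}).
Local Notation inner := (@inner d T R P).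
Local Notation weq := (weq inner).
Local Notation L2 := (@L2 d T R P).
Local Notation ipI := (inner_semi_inner P).

Definition events_of (n : nat) : set_system T := g_sigma_algebra_preimage (X n).

Definition cylinders (M : set nat) : set_system T :=
  [set C | exists (J : {fset nat}) (A : nat -> set T),
    [/\ [set` J] `<=` M, forall n, events_of n (A n) &
        C = \bigcap_(n in [set` J]) A n]].

Lemma events_ofT n : events_of n setT.
Proof. by exists setT => //; rewrite preimage_setT setTI. Qed.

Lemma events_ofI n A B :
  events_of n A -> events_of n B -> events_of n (A `&` B).
Proof.
move=> [A' mA' <-] [B' mB' <-]; exists (A' `&` B'); first exact: measurableI.
by rewrite preimage_setI !setTI.
Qed.

Lemma events_of_measurable n : events_of n `<=` measurable.
Proof. by move=> _ [B mB <-]; exact: (measurable_funPT (X n)). Qed.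

Lemma sigma_of_sigma_algebra M : sigma_algebra setT (sigma_of X M).
Proof. exact: smallest_sigma_algebra. Qed.

Lemma sigma_of_measurable M : sigma_of X M `<=` measurable.
Proof.
apply: smallest_sub; first exact: sigma_algebra_measurable.
by move=> A [n _]; exact: events_of_measurable.
Qed.

Lemma sigma_of_mono M N : M `<=` N -> sigma_of X M `<=` sigma_of X N.
Proof.
move=> MN; apply: sub_smallest2r; first exact: smallest_sigma_algebra.
by move=> A [n Mn An]; exists n => //; exact: MN.
Qed.

Lemma cylinders_sigma_of M : cylinders M `<=` sigma_of X M.
Proof.
move=> _ [J [A [JM hA ->]]].
pose G := \bigcup_(j in M) g_sigma_algebra_preimage (X j).
apply: (@bigcap_measurableType _ (g_sigma_algebraType G)) => n Jn.
by apply: sub_sigma_algebra; exists n; [exact: JM|exact: hA].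
Qed.

Lemma cylinders_measurable M : cylinders M `<=` measurable.
Proof. by move=> A /cylinders_sigma_of; exact: sigma_of_measurable. Qed.

Lemma cylindersT M : cylinders M setT.
Proof.
exists fset0, (fun=> setT); split => //; first by move=> n; exact: events_ofT.
by apply/seteqP; split.
Qed.

Lemma cylindersI M : setI_closed (cylinders M).
Proof.
move=> _ _ [J [A [JM hA ->]]] [J' [A' [JM' hA' ->]]].
(* outside its index set a cylinder imposes no condition *)
pose ext (K : {fset nat}) (B : nat -> set T) n := if n \in K then B n else setT.
have extI K B n : (forall n, events_of n (B n)) -> events_of n (ext K B n).
  by rewrite /ext; case: ifP => // _ _; exact: events_ofT.
exists (J `|` J')%fset, (fun n => ext J A n `&` ext J' A' n); split.
- by move=> n /=; rewrite inE => /orP[/JM|/JM'].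
- by move=> n; apply: events_ofI; exact: extI.
apply/seteqP; split => [x [xA xA'] n _|x h].
  by split; rewrite /ext; case: ifP => // nJ; [exact: xA|exact: xA'].
split=> n /= nJ; have [|] := h n; rewrite /= ?inE ?nJ ?orbT//.
  by rewrite /ext nJ.
by rewrite /ext nJ.
Qed.

Lemma sigma_of_cylinders M : sigma_of X M `<=` <<s cylinders M >>.
Proof.
apply: sub_smallest2r; first exact: smallest_sigma_algebra.
move=> A [n Mn An].
exists [fset n]%fset, (fun k => if k == n then A else setT); split.
- by move=> k /=; rewrite inE => /eqP ->.
- by move=> k; case: eqP => [->//|_]; exact: events_ofT.
apply/seteqP; split=> [x Ax k /=|x /(_ n)/=]; rewrite inE.
  by move=> /eqP ->; rewrite eqxx.
by rewrite eqxx; exact.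
Qed.

(** By the pi-lambda theorem, vanishing integrals over the cylinders give
    vanishing integrals over the events they generate. *)
Lemma inner_eq0_of_cylinders M (w z : L2) :
  (forall A, cylinders M A -> (\int[P]_(x in A) (w x)%:E = 0)%E) ->
  sub_measurable (sigma_of X M) z -> inner w z = 0.
Proof.
move=> w0; apply: inner_eq0_of_integrals.
- exact: sigma_of_sigma_algebra.
- exact: sigma_of_measurable.
move=> A /sigma_of_cylinders; apply: pi_lambda_integral => //.
- exact: cylindersI.
- exact: cylinders_measurable.
- exact: cylindersT.
Qed.

Context (hX : mutually_independent X).

Lemma independent_events (J : {fset nat}) (A : nat -> set T) :
  (forall n, events_of n (A n)) ->
  P (\bigcap_(n in [set` J]) A n) = (\prod_(n <- J) fine (P (A n)))%:E.
Proof.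
move=> hA; have hB n : exists B : set (E n), measurable B /\ X n @^-1` B = A n.
  by have [B mB <-] := hA n; exists B; split => //; rewrite setTI.
pose B n := projT1 (cid (hB n)).
have BP n : measurable (B n) /\ X n @^-1` B n = A n := projT2 (cid (hB n)).
rewrite (_ : \bigcap_(n in [set` J]) A n =
    \bigcap_(n in [set` J]) (X n @^-1` B n)).
  by rewrite hX => [|n]; [under eq_bigr do rewrite (BP _).2|exact: (BP n).1].
by apply: eq_bigcapr => n _; rewrite (BP n).2.
Qed.

Lemma independent_cylinders K L A B : K `&` L = set0 ->
  cylinders K A -> cylinders L B ->
  fine (P (A `&` B)) = fine (P A) * fine (P B).
Proof.
move=> KL [J [A' [JK hA ->]]] [J' [B' [J'L hB ->]]].
have dis n : n \in J -> n \in J' -> False.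
  by move=> /JK nK /J'L nL; have : (K `&` L) n by []; rewrite KL.
pose C n := if n \in J then A' n else B' n.
rewrite (_ : _ `&` _ = \bigcap_(n in [set` (J `|` J')%fset]) C n); last first.
  apply/seteqP; split => [x [xA xB] n /=|x h].
    rewrite inE /C; case: ifP => [nJ _|nJ /=]; [exact: xA|exact: xB].
  split => n /= nJ; have := h n; rewrite /C /= inE nJ ?orbT; first exact.
  by case: ifP => [/dis/(_ nJ)//|_]; exact.
rewrite !independent_events//=; last by move=> n; rewrite /C; case: ifP.
rewrite (perm_big (enum_fset J ++ enum_fset J'))/=; last first.
  apply: uniq_perm; first exact: fset_uniq.
    rewrite cat_uniq !fset_uniq andbT; apply/hasPn => n nJ'.
    by apply/negP => /dis; exact.
  by move=> n; rewrite mem_cat inE.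
rewrite big_cat/=; congr (_ * _).
  by rewrite big_seq [RHS]big_seq; apply: eq_bigr => n nJ; rewrite /C ifT.
rewrite big_seq [RHS]big_seq; apply: eq_bigr => n nJ; rewrite /C ifF//.
by apply/negP => /dis; exact.
Qed.

(** The centred indicator of [B] has integral zero over the cylinders on [K]. *)
Lemma independent_inner K L (z : L2) B (mB : measurable B) : K `&` L = set0 ->
  sub_measurable (sigma_of X K) z -> cylinders L B ->
  inner (indic_L2 P mB) z = fine (P B) * inner (cst_L2 P 1) z.
Proof.
move=> KL mz cB.
suff : inner (indic_L2 P mB - fine (P B) *: cst_L2 P 1) z = 0.
  by rewrite (ipBl ipI) (ipZl ipI) => /eqP; rewrite subr_eq0 => /eqP.
apply: inner_eq0_of_cylinders mz => A cA; have mA := cylinders_measurable cA.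
rewrite (integral_indicE _ mA) (ipBl ipI) (ipZl ipI).
rewrite inner_indic inner_cst_indic mul1r setIC (independent_cylinders KL)//.
by rewrite mulrC subrr.
Qed.

Definition condE (M : set nat) : L2 -> L2 :=
  cond_exp_L2 (sigma_of_sigma_algebra M) (@sigma_of_measurable M).

Lemma condE_sub_measurable M (f : L2) :
  sub_measurable (sigma_of X M) (condE M f).
Proof. exact: sub_measurable_cond_exp. Qed.

Lemma condE_sym M (f g : L2) : inner (condE M f) g = inner f (condE M g).
Proof. exact: inner_cond_expC. Qed.

Lemma condE_id M (z : L2) : sub_measurable (sigma_of X M) z ->
  weq (condE M z) z.
Proof. exact: cond_exp_id. Qed.

(** On functions of the variables in [K], conditioning on the variables in [L]
    amounts to conditioning on those in [K `&` L]: a cylinder over [L] is the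
    intersection of a cylinder over [K `&` L] with an event independent of
    [K]. *)
Lemma condE_condE K L (f g : L2) :
  inner (condE L (condE K f)) g = inner (condE (L `&` K) f) g.
Proof.
set z := condE K f; have mz : sub_measurable (sigma_of X K) z.
  exact: condE_sub_measurable.
have LK_K := @sigma_of_mono (L `&` K) K (@subIsetr _ _ _).
have LK_L := @sigma_of_mono (L `&` K) L (@subIsetl _ _ _).
have -> : inner (condE (L `&` K) f) g = inner (condE (L `&` K) z) g.
  rewrite !condE_sym [RHS](ipC ipI).
  rewrite (_ : inner _ f = inner (condE (L `&` K) g) f).
    by rewrite (ipC ipI).
  apply: condE_id.
  by apply: sub_measurable_mono LK_K _; exact: condE_sub_measurable.
clearbody z; pose v := z - condE (L `&` K) z.
have mv : sub_measurable (sigma_of X K) v.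
  apply: measurable_funB => //.
  by apply: sub_measurable_mono LK_K _; exact: condE_sub_measurable.
have v0 A : cylinders L A -> (\int[P]_(x in A) (v x)%:E = 0)%E.
  move=> [J [B [JL hB AE]]].
  pose A1 := \bigcap_(n in [set` [fset n in J | n \in K]%fset]) B n.
  pose A2 := \bigcap_(n in [set` [fset n in J | n \notin K]%fset]) B n.
  have AE' : A = A1 `&` A2.
    rewrite AE; apply/seteqP; split => [x xB|x [x1 x2] n /= nJ].
      by split => n /=; rewrite !inE => /andP[nJ _]; exact: xB.
    by have [nK|nK] := boolP (n \in K); [apply: x1|apply: x2];
      rewrite /= !inE/= nJ.
  have cA1 : cylinders (L `&` K) A1.
    eexists; exists B; split; [|exact: hB|reflexivity].
    by move=> n /=; rewrite !inE/= => /andP[/JL nL]; rewrite inE.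
  have cA2 : cylinders (~` K) A2.
    eexists; exists B; split; [|exact: hB|reflexivity].
    by move=> n /=; rewrite !inE/= => /andP[_ /negP]; rewrite inE.
  have mA1 := cylinders_measurable cA1; have mA2 := cylinders_measurable cA2.
  have mA := measurableI _ _ mA1 mA2; rewrite AE' (integral_indicE _ mA).
  have -> : inner v (indic_L2 P mA) = inner (indic_L2 P mA2) (cut v mA1).
    rewrite (ipC ipI) /indic_L2 !inner_cut Rintegral_mkcondl.
    apply: eq_Rintegral => x _; rewrite patchE /= indicE !mul1r.
    by case: ifPn => _; rewrite ?mulr1 ?mulr0.
  rewrite (independent_inner mA2 (setICr K) _ cA2); last first.
    by apply: sub_measurable_cut => //; apply: LK_K; exact: cylinders_sigma_of.
  rewrite (ipC ipI) inner_cutC -/(indic_L2 P mA1) /v (ipBl ipI).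
  rewrite /condE inner_cond_exp ?subrr ?mulr0//.
  apply: sub_measurable_cut; first exact: cylinders_sigma_of.
  exact: sub_measurable_cst.
transitivity (inner (condE L (condE (L `&` K) z)) g); last first.
  apply: condE_id; apply: sub_measurable_mono LK_L _.
  exact: condE_sub_measurable.
rewrite !(condE_sym L); apply/eqP; rewrite -subr_eq0 -(ipBl ipI); apply/eqP.
apply: inner_eq0_of_cylinders v0 _; exact: condE_sub_measurable.
Qed.

(** A function of all the variables is null if it is orthogonal to the functions
    of finitely many of them, among which are the indicators of cylinders. *)
Lemma condE_total (z : L2) : sub_measurable (sigma_of X [set: nat]) z ->
  (forall (M : {fset nat}) (y : L2), inner z (condE [set` M] y) = 0) ->
  inner z z = 0.
Proof.
move=> mz h; apply: inner_eq0_of_cylinders mz => A cA.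
have [J [B [_ hB AE]]] := cA.
have cJ : cylinders [set` J] A by exists J, B; split.
have mA := cylinders_measurable cA; rewrite (integral_indicE _ mA).
rewrite (ipC ipI) -(condE_id (M := [set` J])); first by rewrite (ipC ipI) h.
apply: sub_measurable_cut; first exact: cylinders_sigma_of.
exact: sub_measurable_cst.
Qed.

(** Over the empty family the only cylinder is the whole space. *)
Lemma condE_set0 (f : L2) : weq (condE set0 f) (cst_L2 P (fine 'E_P[f])).
Proof.
move=> g; set c := cst_L2 _ _.
rewrite -(condE_id (M := set0) (z := c)); last exact: sub_measurable_cst.
rewrite !condE_sym; apply/eqP; rewrite -subr_eq0 -(ipBl ipI); apply/eqP.
apply: inner_eq0_of_cylinders; last exact: condE_sub_measurable.
move=> A [J [B [J0 hB ->]]].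
have -> : \bigcap_(n in [set` J]) B n = setT.
  by apply/seteqP; split => // x _ n /J0.
rewrite (integral_indicE _ measurableT) (ipBl ipI) inner_cst_indic.
rewrite probability_setT mulr1; congr (_%:E).
apply/eqP; rewrite subr_eq0; apply/eqP.
rewrite -inner_cutC inner_cut unlock; congr fine.
by apply: eq_integral => x _; rewrite /= mulr1.
Qed.

End independence.

(** * Translation into statements about functions *)

#[local] Existing Instance totally_filter.

Section functions.
Context d (T : measurableType d) (R : realType) (P : probability T R).
Local Notation L2 := (L2 P).

Lemma L2_sumE I (r : seq I) (D : pred I) (f : I -> L2) x :
  (\sum_(i <- r | D i) f i : L2) x = \sum_(i <- r | D i) f i x.
Proof. by apply: (big_morph (fun g : L2 => g x)). Qed.

Lemma has_sum_L2_sum (I : choiceType) (D : pred I) (f : I -> L2) (s : L2) :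
  has_sum (@inner _ _ _ P) D f s -> L2_sum P D (fun i => f i : T -> R) s.
Proof.
move=> hs; split; [by move=> i _; exact: LfunP|exact: LfunP|].
rewrite (_ : (fun J : {fset I} => _) =
    (fun J => (Num.sqrt (inner (s - \sum_(i <- J | D i) f i)
                               (s - \sum_(i <- J | D i) f i)))%:E)); last first.
  apply/funext => J; rewrite -Lnorm2E; congr (Lnorm _ _ _); apply/funext => x.
  by rewrite /= -L2_sumE.
apply: cvg_EFin; first exact: nearW.
apply/cvgrPdist_le => /= e e0.
have [J0 hJ0] := hs (e ^+ 2) (exprn_gt0 2 e0).
exists J0 => // J /= /hJ0 hJ; rewrite sub0r normrN ger0_norm ?sqrtr_ge0//.
by rewrite -[e]gtr0_norm// -sqrtr_sqr ler_wsqrtr.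
Qed.

Context (dE : nat -> measure_display) (E : forall n, measurableType (dE n)).
Context (X : forall n, {RV P >-> E n}).

Lemma iter_DopE s (f : L2) :
  iter_Dop X s f = differences (condE X) s f.
Proof. by elim: s => //= k s ->. Qed.

Lemma hoeffding_componentE M (f : L2) :
  hoeffding_component X f M = component (condE X) f M.
Proof. by apply/funext => x; rewrite [RHS]L2_sumE. Qed.

End functions.

Theorem corollary2p4 (R : realType) (d : measure_display)
    (T : measurableType d) (P : probability T R)
    (dE : nat -> measure_display) (E : forall n, measurableType (dE n))
    (X : forall n, {RV P >-> E n}) (hX : mutually_independent X)
    (F : T -> R) (hF : L2X X F) :
  [/\
    (forall (p : nat) (M : {fset nat}) (i : p.-tuple nat),
       #|` M| = p -> M = [fset k in tval i]%fset ->
       hoeffding_component X F M =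
       cond_exp P (sigma_of X [set` M]) (iter_Dop X i F) %[ae P]),
    (exists (S : nat -> T -> R) (Stot : T -> R),
       [/\ forall p, (0 < p)%N ->
             L2_sum P (fun i : p.-tuple nat => sorted ltn i)
               (fun i => cond_exp P (sigma_of X [set` i]) (iter_Dop X i F)) (S p),
           L2_sum P (fun p => (0 < p)%N) S Stot &
           F = (fun x => fine 'E_P[F] + Stot x) %[ae P]]) &
    (exists (S : nat -> T -> R) (Stot : T -> R),
       [/\ forall p, (0 < p)%N ->
             L2_sum P (fun i : p.-tuple nat => uniq i)
               (fun i => cond_exp P (sigma_of X [set` i]) (iter_Dop X i F)) (S p),
           L2_sum P (fun p => (0 < p)%N) (fun p x => (p`!%:R)^-1 * S p x) Stot &
           F = (fun x => fine 'E_P[F] + Stot x) %[ae P]])].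
Proof.
have [f fE] : exists f : L2 P, F = f by exists (Lfun_Sub (lee1n 2) hF.1).
have mf : sub_measurable (sigma_of X setT) f by rewrite -fE; exact: hF.2.
rewrite fE {F hF fE}.
have ipI := inner_semi_inner P.
have Esym := @condE_sym _ _ _ P _ E X.
have EI : forall K L (x y : L2 P),
    inner (condE X K (condE X L x)) y = inner (condE X (K `&` L) x) y.
  by move=> K L x y; exact: condE_condE.
have ae0 : (condE X set0 f : T -> R) = cst (fine 'E_P[f]) %[ae P].
  by have := ae_of_inner (condE_set0 X f).
pose C (g : L2 P) := sub_measurable (sigma_of X setT) g.
have C0 : C 0 by exact: (@sub_measurable_cst _ _ _ P (sigma_of X setT) 0).
have CL a y z : C y -> C z -> C (a *: y + z).
  move=> my mz; apply: measurable_funD => //.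
  by apply: measurable_funM => //; exact: measurable_cst.
have CE K x : C (condE X K x).
  have h : sub_measurable (sigma_of X K) (condE X K x).
    exact: condE_sub_measurable.
  by apply: sub_measurable_mono h; exact: sigma_of_mono.
have Cc : sq_complete (@inner _ _ _ P) C.
  by apply: L2_complete; exact: sigma_of_measurable.
have Ctot z : C z ->
    (forall (M : {fset nat}) y, inner z (condE X [set` M] y) = 0) ->
    inner z z = 0.
  exact: condE_total.
have [S [Ssorted Suniq Stot]] :=
  chaos_expansion ipI Esym EI C0 CL Cc CE Ctot mf.
have fE : (f : T -> R) =
    (fun x => fine 'E_P[f] + (f - condE X set0 f : L2 P) x) %[ae P].
  apply: filterS ae0 => x + _ => /(_ I) h.
  by rewrite L2_addE L2_oppE h addrC subrK.
have termE p : (fun i : p.-tuple nat =>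
      cond_exp P (sigma_of X [set` i]) (iter_Dop X i f)) =
    (fun i => condE X [set` i] (differences (condE X) i f) : T -> R).
  by apply/funext => i; rewrite iter_DopE.
split.
- move=> p M i + ME; rewrite ME => Mp; rewrite hoeffding_componentE iter_DopE.
  have ui : uniq i.
    move: Mp; rewrite card_fseq => /eqP; rewrite -{2}(size_tuple i) => /eqP h.
    by have := ltn_size_undup i; rewrite h ltnn => /esym/negbFE.
  exact: (ae_of_inner (component_differences ipI Esym EI f ui)).
- exists (fun p => S p : T -> R), (f - condE X set0 f : L2 P); split => //.
    move=> p _; rewrite termE; exact: has_sum_L2_sum (Ssorted p).
  exact: has_sum_L2_sum Stot.
- exists (fun p => (p`!%:R *: S p : L2 P) : T -> R).
  exists (f - condE X set0 f : L2 P).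
  split => //.
    move=> p _; rewrite termE; exact: has_sum_L2_sum (Suniq p).
  rewrite (_ : (fun p x => _) = (fun p => S p : T -> R)).
    exact: has_sum_L2_sum Stot.
  by apply/funext => p; apply/funext => x; rewrite L2_scaleE mulKf.
Qed.
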